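(* Let $G$ be a finite group with a Klein-four Sylow $2$-subgroup $P\cong C_2\times C_2$, and let $k$ be an algebraically closed field of characteristic $2$. Put $N:=N_G(P)$ and let $f$ be the Green correspondence with respect to $(G,P,N)$. Let $1a$ be any one-dimensional $kN$-module and let $f^{-1}(1a)$ be its $kG$-Green correspondent. (a) If $f^{-1}(1a)$ belongs to a $2$-block of $G$ containing a one-dimensional $kG$-module, then $f^{-1}(1a)$ is endo-trivial. In particular, if $1a$ lies in the principal block of $N$, then $f^{-1}(1a)$ is endo-trivial. (b) If $O_{2'}(C_G(u))$ is abelian for every $u\in P$ with $u\neq 1$, then $f^{-1}(1a)$ is endo-trivial.
   Context: Modules are finitely generated. A $kG$-module $M$ is endo-trivial if $\operatorname{End}_k(M)\cong k_G\oplus(\text{projective})$ as $kG$-modules, $k_G$ the trivial module. The Green correspondent $f^{-1}(1a)$ is the unique indecomposable $kG$-module with vertex $P$ whose restriction to $N$ has $1a$ as a direct summand. $O_{2'}(X)$ is the largest normal subgroup of odd order of a finite group $X$. *)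

(* Defs.v *)
From HB Require Import structures.
From mathcomp Require Import all_boot all_order all_algebra all_fingroup.
From mathcomp Require Import all_solvable all_field all_character.
Set Implicit Arguments.
Unset Strict Implicit.
Unset Printing Implicit Defensive.
Import GRing.Theory.
Local Open Scope ring_scope.

(* A finitely generated kG-module is a bundled matrix representation
   [representation k G], acting on row vectors from the right; left modules
   correspond to these via g |-> g^-1.  Isomorphism of modules is [mx_rsim],
   and [dadd_grepr] is the direct sum. *)

Section Modules.

Variables (k : fieldType) (gT : finGroupType).
Implicit Types G H N Q R : {group gT}.

Fact triv_mx_repr G : mx_repr G (fun _ : gT => 1%:M : 'M[k]_1).
Proof. by split=> // x y _ _; rewrite mulmx1. Qed.

Definition triv_grepr G : representation k G :=
  Representation (MxRepresentation (triv_mx_repr G)).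

(* End_k(M), flattened by [mxvec]: x sends A to rM(x)^-1 A rM(x). *)
Definition end_mx G (M : representation k G) (x : gT) :
    'M[k]_(rdegree M * rdegree M) :=
  lin_mx (mulmx (M x^-1%g)) *m lin_mx (mulmxr (M x)).

Fact end_mx_repr G (M : representation k G) : mx_repr G (end_mx M).
Proof.
have endE x (A : 'M[k]_(rdegree M)) :
    mxvec A *m end_mx M x = mxvec (M x^-1%g *m A *m M x).
  by rewrite /end_mx mulmxA !mul_vec_lin.
have eqE (B C : 'M[k]_(rdegree M * rdegree M)) :
    (forall A : 'M[k]_(rdegree M), mxvec A *m B = mxvec A *m C) -> B = C.
  move=> eBC; apply/row_matrixP=> i; rewrite !rowE.
  by rewrite -[delta_mx 0 i]vec_mxK.
split=> [|x y Gx Gy]; apply: eqE => A.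
  by rewrite endE invg1 repr_mx1 mul1mx !mulmx1.
rewrite endE [RHS]mulmxA !endE invMg !repr_mxM ?groupV //.
by rewrite !mulmxA.
Qed.

Definition end_grepr G (M : representation k G) : representation k G :=
  Representation (MxRepresentation (end_mx_repr M)).

Definition res_grepr G H (sHG : H \subset G) (M : representation k G) :
    representation k H :=
  Representation (subg_repr M sHG).

(* The induced module is the direct sum of the translates L t, for t in the
   transversal [repr @: rcosets H G]; since (v t) x = (v (t x u^-1)) u when
   H t x = H u, its (t, u) block at x is L(t x u^-1), or 0 if t x u^-1 is
   not in H. *)
Definition rcoset_rep H G (i : 'I_#|rcosets H G|) : gT := repr (enum_val i).

Definition ind_block G H (L : representation k H) x
    (i j : 'I_#|rcosets H G|) : 'M[k]_(rdegree L) :=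
  let y := (rcoset_rep i * x * (rcoset_rep j)^-1)%g in
  if y \in H then L y else 0.

Definition ind_mx G H (L : representation k H) (x : gT) :=
  \mxblock_(i < #|rcosets H G|, j < #|rcosets H G|) ind_block L x i j.

Lemma rcoset_repP G H (i : 'I_#|rcosets H G|) :
  H \subset G ->
  rcoset_rep i \in G /\ enum_val i = (H :* rcoset_rep i)%g.
Proof.
move=> sHG; have /rcosetsP[z Gz ez] := enum_valP i.
rewrite /rcoset_rep ez; split; last by rewrite rcoset_repr.
have /rcosetP[h Hh ->] := mem_repr_rcoset H z.
by rewrite groupM // (subsetP sHG).
Qed.

Lemma rcoset_rep_in G H (i j : 'I_#|rcosets H G|) x : H \subset G ->
  ((rcoset_rep i * x * (rcoset_rep j)^-1)%g \in H) =
  ((H :* (rcoset_rep i * x))%g == enum_val j).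
Proof.
move=> sHG; have [_ ->] := rcoset_repP j sHG.
by rewrite -mem_rcoset; apply/idP/eqP => [/rcoset_eqP|/rcoset_eqP].
Qed.

Fact ind_mx_repr G H (sHG : H \subset G) (L : representation k H) :
  mx_repr G (@ind_mx G H L).
Proof.
split=> [|x y Gx Gy].
  rewrite -mxdiagZ /ind_mx /mxdiag; apply: eq_mxblock => i j.
  rewrite /ind_block rcoset_rep_in // mulg1.
  have [_ <-] := rcoset_repP i sHG; rewrite (inj_eq enum_val_inj).
  by case: eqVneq => // ->; rewrite conform_mx_id mulgV repr_mx1.
rewrite /ind_mx mul_mxblock; apply: eq_mxblock => i l.
have [Gi _] := rcoset_repP i sHG.
have Hj : (H :* (rcoset_rep i * x))%g \in rcosets H G.
  by apply/rcosetsP; exists (rcoset_rep i * x)%g; rewrite ?groupM.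
pose j := enum_rank_in Hj (H :* (rcoset_rep i * x))%g.
have ej : enum_val j = (H :* (rcoset_rep i * x))%g by rewrite enum_rankK_in.
have Hij : (rcoset_rep i * x * (rcoset_rep j)^-1)%g \in H.
  by rewrite rcoset_rep_in // ej.
rewrite (bigD1 j) //= big1 ?addr0 => [|j' ne_j'j]; last first.
  rewrite {1}/ind_block rcoset_rep_in // -ej (inj_eq enum_val_inj).
  by rewrite eq_sym (negPf ne_j'j) mul0mx.
rewrite /ind_block Hij.
have -> : (rcoset_rep i * (x * y) * (rcoset_rep l)^-1 =
    (rcoset_rep i * x * (rcoset_rep j)^-1) *
    (rcoset_rep j * y * (rcoset_rep l)^-1))%g by rewrite !mulgA mulgKV.
rewrite groupMl //; case: ifP => [Hjl|_]; last by rewrite mulmx0.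
by rewrite repr_mxM.
Qed.

Definition ind_grepr G H (sHG : H \subset G) (L : representation k H) :
    representation k G :=
  Representation (MxRepresentation (ind_mx_repr sHG L)).

Definition is_summand G (L M : representation k G) : Prop :=
  exists L' : representation k G, mx_rsim M (dadd_grepr L L').

Definition projective G (M : representation k G) : Prop :=
  exists m : nat,
    is_summand M (muln_grepr (Representation (regular_repr k G)) m).

Definition indecomposable G (M : representation k G) : Prop :=
  (0 < rdegree M)%N /\
  forall M1 M2 : representation k G, mx_rsim M (dadd_grepr M1 M2) ->
    rdegree M1 = 0%N \/ rdegree M2 = 0%N.

Definition endo_trivial G (M : representation k G) : Prop :=
  exists Q : representation k G,
    projective Q /\ mx_rsim (end_grepr M) (dadd_grepr (triv_grepr G) Q).

Definition rel_projective G H (M : representation k G) : Prop :=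
  exists (sHG : H \subset G) (L : representation k H),
    is_summand M (ind_grepr sHG L).

Definition is_vertex G Q (M : representation k G) : Prop :=
  rel_projective Q M /\
  forall R, R \subset Q -> rel_projective R M -> R :=: Q.

Definition green_correspondent G N Q (sNG : N \subset G)
    (L : representation k N) (M : representation k G) : Prop :=
  [/\ indecomposable M, is_vertex Q M & is_summand L (res_grepr sNG M)].

(* A block of kG is given by its block idempotent, i.e. a primitive idempotent
   of the centre of kG; [group_ring k G] is kG, as the enveloping algebra of
   the regular representation. *)
Definition central_idempotent G (e : 'M[k]_#|G|) : Prop :=
  (e \in 'Z(group_ring k G))%MS /\ e *m e = e.

Definition is_block G (e : 'M[k]_#|G|) : Prop :=
  [/\ central_idempotent e, e != 0
    & forall e1 e2 : 'M[k]_#|G|,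
        central_idempotent e1 -> central_idempotent e2 ->
        e1 *m e2 = 0 -> e = e1 + e2 -> e1 = 0 \/ e2 = 0].

Definition in_block G (e : 'M[k]_#|G|) (M : representation k G) : Prop :=
  gring_op M e = 1%:M.

Definition is_principal_block G (e : 'M[k]_#|G|) : Prop :=
  is_block e /\ in_block e (triv_grepr G).

End Modules.

(* Main.v *)
Require Import Defs.
From mathcomp Require Import all_boot all_order all_algebra all_fingroup.
From mathcomp Require Import all_solvable all_field all_character.
From mathcomp Require Import ring.

(** Write N for the normaliser of P, and let M be the Green correspondent of the
    linear module 1a. Let v span a copy of 1a in the restriction of M to N.

    A module is endo-trivial as soon as its restriction to P is the sum of a
    trivial and a projective module [endo_trivial_criterion]. Traces from proper
    subgroups of P form an ideal of End_P(M), modulo which a trace from N to G is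
    the endomorphism it starts from. As End_G(M) is local, this shows that M is a
    summand of the module induced from 1a, with v as a generator, and that over P
    the complement of v is relatively projective to the subgroups of order 2
    [trivial_source_decomposition]. That complement is therefore projective once
    it is free over each subgroup of order 2, that is once the Brauer quotient
    M(u) = ker(u - 1) / im(u - 1) is the line spanned by v, for all u <> 1 in P.

    Let O be the normal 2-complement of the centraliser of u. By fusion in P,
    M(u) is spanned by the translates of v under O [ker_image_span], so it is
    enough that O maps v to multiples of v modulo im(u - 1). This is read off
    from the action of the centre of kG on M. A central element acts nilpotently
    or invertibly on the indecomposable module M; on M(u) it acts as its part
    supported on the centraliser of u, and modulo proper traces as its part
    supported on the centraliser of P.

    - Suppose that the block of M contains a linear module with character lam,
      and let z be the sum of lam(x^-1) x over the elements x of odd order in G.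
      Then z acts on the linear module as the number of these elements, which is
      odd; so z acts invertibly on the block. On M(u) it acts as the sum of
      lam(x^-1) x over O. Hence O acts on M(u) through lam [linear_block_span].

    - Suppose that 1a is in the principal block of N. Then the elements of odd
      order which centralise P act trivially on 1a. With lam = 1, this shows that
      z is not nilpotent on M, so it is invertible and the same argument applies.

    - Suppose that O is abelian, and let w be in P outside the subgroup generated
      by u. For x in O not centralised by P, the class of u x does not meet the
      centraliser of P, and it meets that of u in u x and u x^w only. So its sum is
      nilpotent on M and acts as x + x^w on M(u); it follows that x = x^w on M(u)
      [swap_involution]. Since y^2 = (y y^w) (y^w)^-1 y for y in O, all of O maps v
      to multiples of v in M(u) [abelian_span]. *)

Set Implicit Arguments.
Unset Strict Implicit.
Unset Printing Implicit Defensive.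
Import GRing.Theory.

(** * Normal 2-complements *)

Local Open Scope group_scope.

(** Right translation by an involution is a product of half the order many
    transpositions. *)
Lemma odd_translation (sT : finGroupType) (t : sT) :
  #[t] = 2 -> odd #|sT|./2 -> odd_perm (perm (mulIg t)).
Proof.
move=> ot oddm; have t1 : t != 1 by apply: contra_eqN ot => /eqP->; rewrite order1.
have tt : t * t = 1 by rewrite -[t * t]/(t ^+ 2) -ot expg_order.
set s := perm _.
have sE x : s x = x * t by rewrite permE.
have ss : s * s = 1 by apply/permP => x; rewrite permM !sE perm1 -mulgA tt mulg1.
have os : #[s] = 2.
  apply: nt_prime_order => //; apply: contra t1 => /eqP s1.
  by have /eqP := sE 1; rewrite s1 perm1 mul1g eq_sym.
have cyc x : #|porbit s x| = 2.
  have -> : porbit s x = [set x; x * t].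
    apply/setP => y; rewrite !inE; apply/porbitP/orP.
      case=> i ->; rewrite -(expg_mod_order s i) os modn2.
      by case: (odd i); rewrite ?expg1 ?expg0 ?perm1 ?sE eqxx; auto.
    by case=> /eqP->; [exists 0%N; rewrite perm1 | exists 1%N; rewrite expg1 sE].
  rewrite cards2; case: eqP => // /(congr1 (mulg x^-1)).
  by rewrite mulVg mulKg => /esym t1'; rewrite t1' eqxx in t1.
have part : #|sT| = (#|porbits s| * 2)%N.
  rewrite -cardsT; apply: card_uniform_partition.
    by move=> _ /imsetP[x _ ->]; apply: cyc.
  have -> : porbits s = [set orbit 'P <[s]> x | x in [set: sT]].
    by apply/setP => A; apply/imsetP/imsetP => -[x _ ->]; exists x; rewrite ?porbitE.
  by apply: orbit_partition; apply/actsP => ? ? ?; rewrite !inE.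
by rewrite /odd_perm part muln2 odd_double addFb; rewrite part muln2 doubleK in oddm.
Qed.

(** Translations by elements of odd order are even permutations, those by
    involutions are odd here: the kernel of the sign of the regular
    representation has index 2. *)
Lemma index2_complement (gT : finGroupType) (X : {group gT}) :
  ~~ odd #|X| -> odd #|X|./2 -> exists2 K : {group gT}, K <| X & #|X| = #|K|.*2.
Proof.
move=> evX oddm.
pose f x := odd_perm (perm (mulIg (subg X x))).
have fM : {in X &, {morph f : x y / x * y}}.
  move=> x y Xx Xy; rewrite /f subgM // -[RHS]odd_permM; congr odd_perm.
  by apply/permP => z; rewrite permM !permE mulgA.
pose F := Morphism fM; exists ('ker F)%G; first exact: ker_normal.
have [t Xt ot] : exists2 t, t \in X & #[t] = 2.
  by have [||t] := @Cauchy _ 2 X; rewrite ?dvdn2 //; exists t.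
have ft : f t = true.
  apply: odd_translation; first by rewrite -[RHS]ot (order_injm (injm_subg X)).
  by rewrite -cardsT -(card_injm (injm_sgval X)) //= im_sgval.
have Fim : F @* X = setT.
  apply/setP => b; rewrite inE; case: b; first by apply/morphimP; exists t.
  by rewrite -[false](morph1 F) mem_morphim ?group1.
have := card_morphim F X; rewrite Fim setIid cardsT card_bool => i2.
by rewrite -(Lagrange (normal_sub (ker_normal F))) -i2 muln2.
Qed.

(** A centre of even order makes the Sylow 2-subgroup split off in two steps,
    each one an instance of the previous lemma: the quotient by the central
    involution has twice odd order, and so has the preimage of its normal
    complement. *)
Lemma klein_complement (gT : finGroupType) (X P : {group gT}) u :
  P \subset X -> #|P| = 4 -> odd #|X : P| ->
  u \in P -> #[u] = 2 -> X \subset 'C[u] ->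
  [/\ X :=: 'O_2^'(X) * P & forall x, x \in X -> odd #[x] -> x \in 'O_2^'(X)].
Proof.
move=> sPX cP oi Pu ou cXu.
have Xu := subsetP sPX u Pu.
have nU : X \subset 'N(<[u]>) by rewrite cents_norm // cent_cycle.
have cX : #|X| = (4 * #|X : P|)%N by rewrite -cP Lagrange.
have nsU : <[u]> <| X by rewrite /normal cycle_subG Xu.
have cXU : #|X / <[u]>| = #|X : P|.*2.
  rewrite card_quotient // -divgS ?cycle_subG // cX -orderE ou.
  by rewrite -[4]/(2 * 2)%N -mulnA mulKn // mul2n.
have [||Kb nKb cKb] := @index2_complement _ (X / <[u]>)%G.
- by rewrite /= cXU odd_double.
- by rewrite /= cXU doubleK.
have cKb' : #|Kb| = #|X : P| by apply: double_inj; rewrite -cKb cXU.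
have [K defKb sUK nK] := inv_quotientN nsU nKb.
have cK : #|K| = #|X : P|.*2.
  rewrite -(Lagrange sUK) -card_quotient ?(subset_trans (normal_sub nK)) //.
  by rewrite -defKb cKb' -[#|_|]/#[u] ou mul2n.
have [||O nO cO] := @index2_complement _ K.
- by rewrite cK odd_double.
- by rewrite cK doubleK.
have cO' : #|O| = #|X : P| by apply: double_inj; rewrite -cO cK.
have hallOK : 2^'.-Hall(K) O.
  rewrite /pHall normal_sub //= /pgroup cO' -odd_2'nat oi pnatNK.
  by rewrite -(divgS (normal_sub nO)) cO cO' -muln2 mulKn ?indexg_gt0.
have defO : 'O_2^'(K) = O := normal_Hall_pcore hallOK nO.
have nOX : O <| X.
  rewrite -defO; apply: char_normal_trans nK; exact: pcore_char.
have hallOX : 2^'.-Hall(X) O.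
  rewrite /pHall normal_sub //= /pgroup cO' -odd_2'nat oi pnatNK.
  by rewrite -(divgS (normal_sub nOX)) cX cO' mulnK ?indexg_gt0.
have defOX : 'O_2^'(X) = O := normal_Hall_pcore hallOX nOX.
rewrite defOX; split=> [|x Xx ox].
  apply/esym/eqP; rewrite eqEcard mul_subG ?(normal_sub nOX) //=.
  rewrite coprime_cardMg ?cX ?cO' ?cP; first by rewrite mulnC.
  by rewrite coprime_sym (@coprimeXl 2 2) // coprime2n.
by rewrite (mem_normal_Hall hallOX nOX) // /p_elt -odd_2'nat.
Qed.

(** * Klein four Sylow subgroups *)

(** Keeping these three facts avoids transporting computations along an
    isomorphism with a concrete group. *)
Definition klein_four (gT : finGroupType) (P : {group gT}) :=
  [/\ abelian P, #|P| = 4 & {in P, forall x, x * x = 1}].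

Lemma isog_klein_four (gT : finGroupType) (P : {group gT}) :
  P \isog [set: 'Z_2 * 'Z_2] -> klein_four P.
Proof.
move=> isoP; split.
- rewrite (isog_abelian isoP); apply/centsP => -[a b] _ [c d] _.
  by congr (_, _); apply: Zp_mulgC.
- by rewrite (card_isog isoP) cardsT card_prod !card_ord.
move=> x Px; case/isogP: isoP => f injf fP; apply: (injmP injf); rewrite ?groupM ?group1 //.
rewrite morphM // morph1; case: (f x) => [a b].
by congr (_, _); apply: val_inj; [case: a | case: b]; do 2?case.
Qed.

Section Klein.

Variables (gT : finGroupType) (G P : {group gT}).
Hypotheses (sylP : 2.-Sylow(G) P) (kP : klein_four P).

Let aP : abelian P. Proof. by case: kP. Qed.
Let cP : #|P| = 4. Proof. by case: kP. Qed.
Let sqP x : x \in P -> x * x = 1. Proof. by case: kP => _ _; apply. Qed.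
Let sPG : P \subset G. Proof. exact: pHall_sub sylP. Qed.

Lemma sylow_index_odd : odd #|G : P|.
Proof. by have /and3P[_ _] := sylP; rewrite -odd_2'nat. Qed.

Lemma klein_order u : u \in P -> u != 1 -> #[u] = 2.
Proof. by move=> Pu u1; apply: nt_prime_order => //; apply: sqP. Qed.

Lemma klein_inv u : u \in P -> u^-1 = u.
Proof. by move=> Pu; apply: (mulgI u); rewrite mulgV sqP. Qed.

Lemma klein_commute u w : u \in P -> w \in P -> u * w = w * u.
Proof. by move=> Pu Pw; apply: (centsP aP). Qed.

Lemma klein_elements u w : u \in P -> w \in P -> u != 1 -> w != 1 -> w != u ->
  P = [set 1; u; w; u * w] :> {set gT} /\ uniq [:: 1; u; w; u * w].
Proof.
move=> Pu Pw u1 w1 wu.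
have un : uniq [:: 1; u; w; u * w].
  have e1 : (u * w == 1) = (w == u).
    by rewrite -(inj_eq (mulgI u)) mulgA sqP // mul1g mulg1.
  have e2 : (u == u * w) = (w == 1).
    by rewrite -{1}[u]mulg1 (inj_eq (mulgI u)) eq_sym.
  have e3 : (w == u * w) = (u == 1).
    by rewrite -{1}[w]mul1g (inj_eq (mulIg w)) eq_sym.
  by rewrite /= !inE !negb_or !(eq_sym 1) e1 e2 e3 (eq_sym u w) u1 w1 wu.
split=> //; apply/eqP; rewrite eq_sym eqEcard cP; apply/andP; split.
  by apply/subsetP => x; rewrite !inE => /orP[/orP[/orP[]|]|] /eqP->; rewrite ?groupM.
have -> : [set 1; u; w; u * w] = [set x in [:: 1; u; w; u * w]].
  by apply/setP => x; rewrite !inE -!orbA.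
by rewrite cardsE (card_uniqP un).
Qed.

Lemma klein_other u : u \in P -> exists w, [/\ w \in P, w != 1 & w != u].
Proof.
move=> Pu; have /subsetPn[w Pw] : ~~ (P \subset [set 1; u]).
  by apply/negP => /subset_leq_card; rewrite cP cards2; case: (_ != _).
by rewrite !inE negb_or => /andP[w1 wu]; exists w.
Qed.

Lemma klein_sub_cent u : u \in P -> P \subset 'C_G[u].
Proof. by move=> Pu; rewrite subsetI sPG sub_cent1 (subsetP aP). Qed.

(** Burnside's fusion argument: as P is abelian, both P and its conjugate by g
    are Sylow subgroups of the centraliser of u. For permutation modules it says
    that u fixes only those cosets of the normaliser which meet its centraliser. *)
Lemma klein_fusion u g : u \in P -> g \in G -> g * u * g^-1 \in P ->
  exists n c, [/\ n \in 'N_G(P), c \in 'C_G[u] & g = n * c].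
Proof.
move=> Pu Gg Pug.
have sylC (Q : {group gT}) : 2.-Sylow(G) Q -> Q \subset 'C_G[u] -> 2.-Sylow('C_G[u]) Q.
  by move=> sQ sQC; apply: pHall_subl sQ; rewrite // subsetIl.
have sPgC : P :^ g \subset 'C_G[u].
  rewrite subsetI -(conjGid Gg) conjSg sPG /= sub_cent1.
  rewrite centJ mem_conjg conjgE invgK mulgA (subsetP aP) //.
have [c Cc defP] := Sylow_trans (sylC _ sylP (klein_sub_cent Pu))
   (sylC (P :^ g)%G (etrans (pHallJ _ _ Gg) sylP) sPgC).
have Gc : c \in G by case/setIP: Cc.
exists (g * c^-1), c; split=> //; last by rewrite mulgKV.
rewrite inE groupM ?groupV //=; apply/normP.
by rewrite conjsgM -[P :^ g]/(gval (P :^ g)%G) /= defP -conjsgM mulgV conjsg1.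
Qed.

Section Centralizer.
Variable u : gT.
Hypotheses (Pu : u \in P) (u1 : u != 1).
Local Notation C := 'C_G[u].
Local Notation O := 'O_2^'('C_G[u]).

Let compl : C = O * P /\ forall x, x \in C -> odd #[x] -> x \in O.
Proof.
have oi : odd #|C : P|.
  have := sylow_index_odd; rewrite -(Lagrange_index (subsetIl G 'C[u]) (klein_sub_cent Pu)).
  by rewrite oddM => /andP[].
by case: (klein_complement (klein_sub_cent Pu) cP oi Pu (klein_order Pu u1)
  (subsetIr _ _)).
Qed.

Lemma cent_invol_mul : C = O * P. Proof. by case: compl. Qed.

Lemma cent_invol_odd x : (x \in O) = (x \in C) && odd #[x].
Proof.
apply/idP/andP => [Ox | [Cx ox]]; last by case: compl => _; apply.
split; first exact: subsetP (pcore_sub _ _) _ Ox.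
by rewrite odd_2'nat; apply: mem_p_elt (pcore_pgroup _ _) Ox.
Qed.

Lemma cent_odd_O x : x \in 'C_G(P) -> odd #[x] -> x \in O.
Proof.
case/setIP=> Gx cPx ox; rewrite cent_invol_odd ox inE Gx /= andbT.
by apply/cent1P/(centP cPx).
Qed.

Lemma O_conj x g : g \in C -> (x ^ g \in O) = (x \in O).
Proof.
move=> Cg; rewrite -mem_conjgV (normP _) //.
by rewrite groupV (subsetP (char_norm (pcore_char _ _))).
Qed.

Hypothesis aO : abelian O.

Section Class.
Variable x : gT.
Hypotheses (Ox : x \in O) (ncx : x \notin 'C(P)).

Let Cx : x \in C. Proof. by move: Ox; rewrite cent_invol_odd => /andP[]. Qed.
Let ux : u * x = x * u.
Proof. by case/setIP: Cx => _ /cent1P. Qed.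

(** The element u x has a centraliser whose Sylow 2-subgroup is generated by u:
    as O is abelian, only the P-component of an element of C = O P matters for
    whether it commutes with x. *)
Lemma cent_class_invol y : y \in G -> commute y (u * x) -> y * y = 1 -> y = 1 \/ y = u.
Proof.
move=> Gy cyux yy.
have ox : odd #[x] by move: Ox; rewrite cent_invol_odd => /andP[].
have cyu : commute y u.
  have <- : (u * x) ^+ #[x] = u.
    by rewrite expgMn // expg_order mulg1 -(expg_mod_order u) (klein_order Pu u1) modn2 ox.
  exact: commuteX.
have cyx : commute y x.
  by have := commuteM (commuteV cyu) cyux; rewrite mulKg.
have : y \in O * P by rewrite -cent_invol_mul inE Gy; apply/cent1P.
case/mulsgP=> o p Oo Pp Dy; have Cp := subsetP (klein_sub_cent Pu) p Pp.
have xp : x ^ p = x.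
  have : x ^ (o * p) = x by rewrite -Dy conjgE -cyx mulKg.
  by rewrite conjgM (conjgE x o) (centsP aO _ Ox _ Oo) mulKg.
have pu : p = 1 \/ p = u.
  have [->|p1] := eqVneq p 1; [by left|]; have [->|pu] := eqVneq p u; [by right|].
  case/negP: ncx; have [defP _] := klein_elements Pu Pp u1 p1 pu.
  have cpx : commute x p by apply/commgP; apply/conjg_fixP.
  apply/centP => z; rewrite defP !inE -!orbA => /or4P[] /eqP-> //.
    exact: commute1.
  by apply: commuteM.
have cop : commute o p.
  have Co : o \in C by move: Oo; rewrite cent_invol_odd => /andP[].
  case: pu => ->; first exact: commute1.
  by case/setIP: Co => _ /cent1P; rewrite /commute => ->.
have o1 : o = 1.
  have oo : o ^+ 2 = 1.
    have := yy; rewrite Dy -[_ * _]/((o * p) ^+ 2) expgMn //.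
    by rewrite (sqP Pp : p ^+ 2 = 1) mulg1.
  have : #[o] %| 2 by rewrite order_dvdn oo.
  have : odd #[o] by move: Oo; rewrite cent_invol_odd => /andP[].
  move=> od /(@dvdn_leq _ 2 isT); case eo: #[o] od => [|[|[]]] // _ _.
  by apply/eqP; rewrite -order_eq1 eo.
by rewrite Dy o1 mul1g.
Qed.

(** The Sylow 2-subgroups of the centraliser of an element of this class have
    order 2, so that centraliser cannot contain P. *)
Lemma class_not_cent k : k \in (u * x) ^: G -> k \notin 'C(P).
Proof.
case/imsetP=> g Gg ->; apply/negP => ckP.
have key p : p \in P -> p != 1 -> p ^ g^-1 = u.
  move=> Pp p1; have Gp := subsetP sPG p Pp.
  have [|||p1'|//] := @cent_class_invol (p ^ g^-1).
  - by rewrite groupJ ?groupV.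
  - have c := centP ckP p Pp; apply: (@conjg_inj _ g).
    by rewrite [LHS]conjMg [RHS]conjMg conjgKV c.
  - by rewrite -conjMg sqP ?conj1g.
  by rewrite -(conjgKV g p) p1' conj1g eqxx in p1.
have [w [Pw w1 wu]] := klein_other Pu.
by case/eqP: wu; apply: (@conjg_inj _ g^-1); rewrite !key.
Qed.

(** If a conjugate of u x by g commutes with u, then u also generates a Sylow
    2-subgroup of its centraliser, so g centralises u. Thus G-fusion of u x in C
    is C-fusion, and C acts on O through P because O is abelian. *)
Lemma class_meet_cent w : w \in P -> w != 1 -> w != u ->
  [/\ (u * x) ^: G :&: C = [set u * x; u * x ^ w] & x != x ^ w].
Proof.
move=> Pw w1 wu; have Gx := subsetP (subsetIl _ _) x Cx.
have Gu := subsetP sPG u Pu; have Gw := subsetP sPG w Pw.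
have uw : u ^ w = u by rewrite conjgE (klein_commute Pu Pw) mulKg.
have [defP _] := klein_elements Pu Pw u1 w1 wu.
have Cw := subsetP (klein_sub_cent Pu) w Pw.
split; last first.
  apply: contra ncx => /eqP xw; apply/centP => z.
  have cwx : commute x w by apply/commgP; apply/conjg_fixP.
  rewrite defP !inE -!orbA => /or4P[] /eqP-> //.
    exact: commute1.
  by apply: commuteM.
apply/setP => k; rewrite in_setI in_set2; apply/andP/orP; last first.
  case=> /eqP->; split.
  - exact: class_refl.
  - by apply: groupM; [apply: (subsetP (klein_sub_cent Pu)) | ].
  - by rewrite -{1}uw -conjMg memJ_class.
  apply: groupM; first by apply: (subsetP (klein_sub_cent Pu)).
  by rewrite groupJ.
case=> /imsetP[g Gg ->] /setIP[_ /cent1P ck].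
have : u ^ g^-1 = 1 \/ u ^ g^-1 = u.
  apply: cent_class_invol; first by rewrite groupJ ?groupV.
    apply: (@conjg_inj _ g).
    by rewrite [LHS]conjMg [RHS]conjMg conjgKV ck.
  by rewrite -conjMg sqP ?conj1g.
case=> [ug|ug]; first by case/eqP: u1; rewrite -(conjgKV g u) ug conj1g.
have ug' : u ^ g = u by rewrite -{1}ug conjgKV.
have Cg : g \in O * P.
  rewrite -cent_invol_mul inE Gg; apply/cent1P; apply/esym.
  by rewrite [LHS]conjgC ug'.
case/mulsgP: Cg => o p Oo Pp Dg.
have xo : x ^ o = x by rewrite conjgE (centsP aO _ Ox _ Oo) mulKg.
have xu : x ^ u = x by rewrite conjgE -ux mulKg.
rewrite conjMg ug' Dg conjgM xo.
move: Pp; rewrite defP !inE -!orbA => /or4P[] /eqP->; rewrite ?conjg1 ?conjgM ?xu; auto.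
Qed.

End Class.
End Centralizer.
End Klein.

Local Close Scope group_scope.
Local Open Scope ring_scope.

(** * Summands, projectivity and blocks *)

(** Fitting's lemma, with the projection on the part where A is invertible given
    as a polynomial in A without constant term. Having it as a polynomial lets
    one apply it inside the centre of a group algebra as well as inside an
    endomorphism algebra. *)
Lemma fitting_idempotent (F : fieldType) n (A : 'M[F]_n) :
  exists (m : nat) (c : nat -> F) (N : nat),
    let B := \sum_(i < m) c i *: A ^+ i in
    let f := A *m B in f *m f = f /\ A ^+ N *m f = A ^+ N.
Proof.
case: n A => [|n] A.
  by exists 0%N, (fun=> 0), 0%N; split; apply/matrixP; case.
(* The characteristic polynomial is h X^a with h prime to X; a Bezout relation
   between h and X^(a + 1) yields the idempotent. *)
have [a [h h0 Dp]] := multiplicity_XsubC (char_poly A) 0.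
rewrite monic_neq0 ?char_poly_monic //= subr0 in h0 Dp *.
have cop : coprimep ('X ^+ a.+1) h.
  by apply: coprimep_expl; rewrite coprimep_sym -['X]subr0 coprimep_XsubC.
have [u [v uv1]] : exists u v : {poly F}, u * 'X ^+ a.+1 + v * h = 1.
  have [[u v] /= ] := Bezout_coprimepP _ _ cop.
  set w := _ + _ => /eqpP[[c1 c2] /= /andP[c1n0 c2n0] e].
  exists ((c1 / c2) *: u), ((c1 / c2) *: v).
  rewrite -!scalerAl -scalerDr -/w mulrC -scalerA e scalerA mulVf //.
  by rewrite scale1r.
pose q := u * 'X ^+ a; exists (size q), (nth 0 q), a => /=.
have -> : \sum_(i < size q) q`_i *: A ^+ i = horner_mx A q.
  rewrite -[in RHS](coefK q) poly_def rmorph_sum; apply: eq_bigr => i _ /=.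
  by rewrite horner_mxZ rmorphXn /= horner_mx_X.
have -> : A *m horner_mx A q = horner_mx A (u * 'X ^+ a.+1).
  by rewrite exprS mulrCA [RHS]rmorphM /= horner_mx_X.
have -> : A ^+ a = horner_mx A ('X ^+ a) by rewrite rmorphXn /= horner_mx_X.
have CH r : horner_mx A (h * 'X ^+ a * r) = 0.
  by rewrite rmorphM /= -Dp Cayley_Hamilton mul0r.
have Au : u * 'X ^+ a.+1 = 1 - v * h by rewrite -uv1 addrK.
split; rewrite mulmxE -rmorphM /=; apply/eqP; rewrite -subr_eq0 -rmorphB /=.
  rewrite -[X in _ - X]mulr1 -mulrBr {2}Au addrAC subrr add0r exprSr.
  by rewrite -(CH (- (u * 'X * v))); apply/eqP; congr horner_mx; ring.
rewrite -[X in _ - X]mulr1 -mulrBr Au addrAC subrr add0r.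
by rewrite -(CH (- v)); apply/eqP; congr horner_mx; ring.
Qed.

Section Modules.

Variables (F : fieldType) (gT : finGroupType) (G : {group gT}).

(** A split embedding a of S in R, with retraction b, exhibits S as a direct
    summand; the complement comes with its own embedding c and retraction d. *)
Lemma split_summand (R S : representation F G)
    (a : 'M_(rdegree S, rdegree R)) (b : 'M_(rdegree R, rdegree S)) :
    (forall x, x \in G -> S x *m a = a *m R x) ->
    (forall x, x \in G -> R x *m b = b *m S x) ->
    a *m b = 1%:M ->
  exists (L : representation F G) (c : 'M_(rdegree L, rdegree R))
         (d : 'M_(rdegree R, rdegree L)),
    [/\ mx_rsim R (dadd_grepr S L),
        forall x, x \in G -> L x *m c = c *m R x,
        forall x, x \in G -> R x *m d = d *m L x,
        c *m d = 1%:M & d *m c = 1%:M - b *m a].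
Proof.
move=> ha hb ab; pose K := kermx b; pose ba := b *m a.
have modK : mxmodule R K.
  apply/mxmoduleP => x Gx; apply/sub_kermxP.
  by rewrite -mulmxA hb // mulmxA mulmx_ker mul0mx.
have hba x : x \in G -> ba *m R x = R x *m ba.
  by move=> Gx; rewrite mulmxA hb // -!mulmxA ha.
have sK : (1%:M - ba <= K)%MS.
  by apply/sub_kermxP; rewrite mulmxBl mul1mx -mulmxA ab mulmx1 subrr.
pose L := Representation (submod_repr modK).
pose c : 'M_(rdegree L, rdegree R) := val_submod (1%:M : 'M_(\rank K)).
pose d : 'M_(rdegree R, rdegree L) := in_submod K (1%:M - ba).
have cb : c *m b = 0 by apply/sub_kermxP; apply: val_submodP.
have dc : d *m c = 1%:M - ba by rewrite -[LHS]val_submodE in_submodK.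
have hc x : x \in G -> L x *m c = c *m R x.
  by move=> Gx; rewrite -[LHS]val_submodE -val_submodJ // mul1mx.
have hd x : x \in G -> R x *m d = d *m L x.
  move=> Gx; rewrite -in_submodJ // {1}/d [in_submod _ _]in_submodE mulmxA.
  by rewrite -in_submodE mulmxBr mulmxBl mulmx1 mul1mx hba.
have cd : c *m d = 1%:M.
  rewrite /d in_submodE mulmxA -in_submodE mulmxBr mulmx1 mulmxA cb mul0mx subr0.
  exact: val_submodK.
have ad : a *m d = 0.
  rewrite /d in_submodE mulmxA -in_submodE mulmxBr mulmx1 mulmxA ab mul1mx.
  by rewrite subrr linear0.
exists L, c, d; split=> //.
have e1 : row_mx b d *m col_mx a c = 1%:M by rewrite mul_row_col dc addrC subrK.
have e2 : col_mx a c *m row_mx b d = 1%:M.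
  by rewrite mul_col_row ab ad cb cd -scalar_mx_block.
exists (row_mx b d).
- apply/eqP; rewrite eqn_leq -{1}(mxrank1 F (rdegree R)) -e1.
  rewrite (leq_trans (mxrankM_maxl _ _)) ?rank_leq_col //=.
  rewrite -{1}(mxrank1 F (_ + _)) -e2.
  by rewrite (leq_trans (mxrankM_maxl _ _)) ?rank_leq_col.
- by apply/row_freeP; exists (col_mx a c).
move=> x Gx; rewrite mul_mx_row /= mul_row_block !mulmx0 addr0 add0r.
by rewrite hb // hd.
Qed.

(** Endomorphism rings of indecomposable modules are local; this is the form in
    which indecomposability is used throughout. *)
Lemma indecomposable_end_local (M : representation F G) (A : 'M_(rdegree M)) :
    indecomposable M -> centgmx M A ->
  (exists N : nat, A ^+ N = 0) \/ A \in unitmx.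
Proof.
case=> _ indM /centgmxP cA.
have [m [c [N]]] := fitting_idempotent A; set B := \sum_(i < m) _.
set f := A *m B => -[ff fN].
have cX i x : x \in G -> A ^+ i *m M x = M x *m A ^+ i.
  move=> Gx; elim: i => [|i IH]; first by rewrite expr0 mulmx1 mul1mx.
  by rewrite exprS -mulmxE -mulmxA IH mulmxA cA // mulmxA.
have cB x : x \in G -> B *m M x = M x *m B.
  move=> Gx; rewrite mulmx_suml mulmx_sumr; apply: eq_bigr => i _.
  by rewrite -scalemxAl -scalemxAr cX.
have cf x : x \in G -> f *m M x = M x *m f.
  by move=> Gx; rewrite -mulmxA cB // mulmxA cA // mulmxA.
have modf : mxmodule M f.
  by apply/mxmoduleP => x Gx; rewrite cf // submxMl.
have modg : mxmodule M (1%:M - f).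
  apply/mxmoduleP => x Gx.
  have -> : (1%:M - f) *m M x = M x *m (1%:M - f).
    by rewrite mulmxBl mulmxBr mul1mx mulmx1 cf.
  exact: submxMl.
have mod1 : mxmodule M 1%:M by apply: mxmodule1.
have def1 : (f + (1%:M - f) :=: 1%:M)%MS.
  apply/eqmxP; rewrite submx1 /=; apply/sub_addsmxP; exists (1%:M, 1%:M).
  by rewrite !mul1mx addrC subrK.
have tI : (f :&: (1%:M - f))%MS = 0.
  apply/eqP; rewrite -submx0; apply/rV_subP => v; rewrite sub_capmx.
  case/andP=> /submxP[a ->] /submxP[b Db].
  rewrite submx0 -[X in a *m X]ff mulmxA Db -mulmxA mulmxBl mul1mx ff subrr.
  by rewrite mulmx0.
have sim : mx_rsim M
    (dadd_grepr (Representation (submod_repr modf))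
                (Representation (submod_repr modg))).
  apply: mx_rsim_trans (mx_rsim_sym (rsim_submod1 mod1 (eqmx_refl _))) _.
  apply: (mx_rsim_dadd (rU := Representation (submod_repr modf))
    (rV := Representation (submod_repr modg)) _ def1); last 2 first.
  - exact: mx_rsim_refl.
  - exact: mx_rsim_refl.
  exact/mxdirect_addsP.
have [/eqP|/eqP] := indM _ _ sim; rewrite mxrank_eq0 => /eqP f0.
  by left; exists N; rewrite -fN -[A *m B]/f f0 mulmx0.
right; move/eqP: f0; rewrite subr_eq0 => /eqP f1.
by have [] := mulmx1_unit (esym f1).
Qed.

Lemma factor_through_copies (R S : representation F G) (I : Type) (r : seq I)
    (a : I -> 'M_(rdegree S, rdegree R)) (b : I -> 'M_(rdegree R, rdegree S)) :
    (forall i x, x \in G -> S x *m a i = a i *m R x) ->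
    (forall i x, x \in G -> R x *m b i = b i *m S x) ->
  let Rm := \big[dadd_grepr/grepr0]_(i <- r) R in
  exists (A : 'M_(rdegree S, rdegree Rm)) (B : 'M_(rdegree Rm, rdegree S)),
    [/\ forall x, x \in G -> S x *m A = A *m Rm x,
        forall x, x \in G -> Rm x *m B = B *m S x
      & A *m B = \sum_(i <- r) a i *m b i].
Proof.
move=> ha hb; elim: r => [|i r [A [B [hA hB AB]]]] /=.
  rewrite !big_nil; exists 0, 0; split=> *; rewrite ?(mul0mx, mulmx0) //.
rewrite !big_cons; exists (row_mx (a i) A), (col_mx (b i) B).
split=> [x Gx|x Gx|]; last by rewrite mul_row_col AB.
  by rewrite mul_mx_row mul_row_block !mulmx0 addr0 add0r ha // hA.
by rewrite [RHS]mul_col_mx [LHS]mul_block_col !mul0mx addr0 add0r hb // hB.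
Qed.

(** One direction of Higman's criterion: the trace relation says that the module
    is a retract of the free module on a basis. *)
Lemma higman_projective (Q : representation F G) (D : 'M_(rdegree Q)) :
  \sum_(g in G) Q g^-1%g *m D *m Q g = 1%:M -> projective Q.
Proof.
move=> trD; pose R := Representation (regular_repr F G).
pose m := rdegree Q.
(* The j-th map to kG sends q to the sum over g of the j-th coordinate of
   q g^-1 D, times g; the j-th map back sends 1 to the j-th basis vector. *)
pose a (j : 'I_m) : 'M[F]_(rdegree Q, rdegree R) :=
  \matrix_(i < rdegree Q, g < #|G|) (Q (enum_val g)^-1%g *m D) i j.
pose b (j : 'I_m) : 'M[F]_(rdegree R, rdegree Q) :=
  \matrix_(g < #|G|) row j (Q (enum_val g)).
have gvP (g : 'I_#|G|) : enum_val g \in G := enum_valP g.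
have ha j x : x \in G -> Q x *m a j = a j *m R x.
  move=> Gx; apply/matrixP => i g; rewrite !mxE.
  pose g' := gring_index G (enum_val g * x^-1).
  have Gg' : (enum_val g * x^-1)%g \in G by rewrite groupM ?groupV.
  have eg' : enum_val g' = (enum_val g * x^-1)%g by rewrite gring_indexK.
  rewrite [RHS](bigD1 g') //= [X in _ = _ + X]big1 => [|h ne_h].
    rewrite !mxE eg' mulgKV gring_valK !eqxx mulr1 addr0.
    transitivity ((Q x *m (Q (enum_val g)^-1%g *m D)) i j).
      by rewrite [RHS]mxE; apply: eq_bigr => l _; rewrite mxE.
    by rewrite mulmxA -repr_mxM ?groupV // invMg invgK mxE.
  rewrite !mxE /=; case: eqP => [eg|]; last by rewrite mulr0.
  case/eqP: ne_h; apply: enum_val_inj; rewrite eg' eg gring_indexK ?groupM //.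
  by rewrite mulgK.
have hb j x : x \in G -> R x *m b j = b j *m Q x.
  move=> Gx; apply/row_matrixP => g.
  have rb h : row h (b j) = row j (Q (enum_val h)) by exact: rowK.
  rewrite !row_mul rb [row g (R x)]rowK -rowE rb gring_indexK ?groupM //.
  by rewrite repr_mxM // row_mul.
have [A [B [hA hB AB]]] :=
  factor_through_copies (index_enum 'I_m) ha hb.
exists m; have [L [_ [_ [sim _ _ _ _]]]] : exists (L : representation F G)
    (c : 'M_(rdegree L, rdegree (muln_grepr R m)))
    (d : 'M_(rdegree (muln_grepr R m), rdegree L)), 
    [/\ mx_rsim (muln_grepr R m) (dadd_grepr Q L), 
        forall x, x \in G -> L x *m c = c *m muln_grepr R m x,
        forall x, x \in G -> muln_grepr R m x *m d = d *m L x,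
        c *m d = 1%:M & d *m c = 1%:M - B *m A].
  apply: split_summand => //; rewrite AB -trD.
  rewrite (reindex_omap enum_val (fun g => Some (gring_index G g))) /=; last first.
    by move=> g Gg; rewrite /= gring_indexK.
  under [RHS]eq_bigl => g do rewrite gvP gring_valK eqxx.
  apply/matrixP => i l; rewrite !summxE.
  transitivity (\sum_(j < m) \sum_(g < #|G|)
     (Q (enum_val g)^-1%g *m D) i j * Q (enum_val g) j l).
    by apply: eq_bigr => j _; rewrite mxE; apply: eq_bigr => g _; rewrite !mxE.
  by rewrite exchange_big; apply: eq_bigr => g _; rewrite mxE.
by exists L.
Qed.

(** The centre of a block is a local ring, so a central element which is not
    nilpotent on one module of the block is invertible on all of them. The
    weights c are the coefficients of the central element. *)
Lemma block_central_unit (e : 'M[F]_#|G|) (X Y : representation F G)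
    (c : gT -> F) :
    is_block e -> in_block e X -> in_block e Y ->
    {in G &, forall x g, c (x ^ g)%g = c x} ->
    (forall N, (\sum_(x in G) c x *: Y x) ^+ N != 0) ->
  \sum_(x in G) c x *: X x \in unitmx.
Proof.
move=> [[Ze ee] _ prime_e] eX eY cJ nnY.
pose z := \sum_(x in G) c x *: regular_repr F G x.
have opz (W : representation F G) : gring_op W z = \sum_(x in G) c x *: W x.
  by rewrite linear_sum; apply: eq_bigr => x Gx; rewrite linearZ /= gring_opG.
have Rz : (z \in group_ring F G)%MS.
  rewrite linear_sum summx_sub // => x Gx.
  by rewrite linearZ scalemx_sub // envelop_mx_id.
have cz x : x \in G -> regular_repr F G x *m z = z *m regular_repr F G x.
  move=> Gx; rewrite mulmx_sumr mulmx_suml (reindex_acts 'J _ Gx) /=; last first.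
    by rewrite astabsJ normG.
  apply: eq_bigr => y Gy; rewrite -scalemxAl -scalemxAr cJ //.
  by rewrite -!repr_mxM ?groupJ // -conjgC.
have [Re ce] := center_mxP Ze.
have cRG (A : 'M[F]_#|G|) :
    (forall x, x \in G -> regular_repr F G x *m A = A *m regular_repr F G x) ->
    (forall B, (B \in group_ring F G)%MS -> B *m A = A *m B).
  move=> cA B /envelop_mxP[b ->]; rewrite mulmx_suml mulmx_sumr.
  by apply: eq_bigr => x Gx; rewrite -scalemxAl -scalemxAr cA.
pose A : 'M[F]_#|G| := e *m z.
have RA : (A \in group_ring F G)%MS by rewrite envelop_mxM.
have RAi i : (A ^+ i \in group_ring F G)%MS.
  elim: i => [|i IH]; first by rewrite expr0 envelop_mx1.
  by rewrite exprS -mulmxE envelop_mxM.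
have cA B : (B \in group_ring F G)%MS -> B *m A = A *m B.
  by move=> RB; rewrite mulmxA (ce _ RB) -mulmxA (cRG _ cz _ RB) mulmxA.
have cAi i B : (B \in group_ring F G)%MS -> B *m (A ^+ i) = (A ^+ i) *m B.
  move=> RB; elim: i => [|i IH]; first by rewrite expr0 mulmx1 mul1mx.
  by rewrite exprS -mulmxE mulmxA cA // -[LHS]mulmxA IH mulmxA.
have [m [k [N /= [ff fN]]]] := fitting_idempotent A.
set B := \sum_(i < m) _ in ff fN; set f := A *m B in ff fN.
have RB : (B \in group_ring F G)%MS.
  by rewrite linear_sum summx_sub // => i _; rewrite linearZ scalemx_sub ?RAi.
have Rf : (f \in group_ring F G)%MS by rewrite envelop_mxM.
have cB C : (C \in group_ring F G)%MS -> C *m B = B *m C.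
  move=> RC; rewrite mulmx_suml mulmx_sumr; apply: eq_bigr => i _.
  by rewrite -scalemxAl -scalemxAr cAi.
have cf C : (C \in group_ring F G)%MS -> C *m f = f *m C.
  by move=> RC; rewrite mulmxA cA // -mulmxA cB // mulmxA.
have ef : e *m f = f by rewrite !mulmxA ee.
have fe : f *m e = f by rewrite -cf.
have Zf : central_idempotent f by split=> //; apply/center_mxP; split.
have Zef : central_idempotent (e - f).
  split; last by rewrite mulmxBl !mulmxBr ee ef fe ff subrr subr0.
  apply/center_mxP; split=> [|C RC]; last by rewrite mulmxBl mulmxBr cf // ce.
  by rewrite linearB /= addmx_sub // eqmx_opp.
(* The Fitting idempotent f of e z splits e, which is primitive: it is 0 if e z
   is nilpotent, and e if e z is invertible in the block. *)
have [||f0|ef0] := prime_e f (e - f) Zf Zef.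
- by rewrite mulmxBr fe ff subrr.
- by rewrite addrC subrK.
- have AN0 : A ^+ N = 0 by rewrite -fN f0 mulmx0.
  have AY i : gring_op Y (A ^+ i) = (gring_op Y z) ^+ i.
    elim: i => [|i IH]; first by rewrite !expr0; apply: gring_op1.
    rewrite !exprS -!mulmxE gring_opM ?RAi // IH gring_opM //.
    by rewrite [gring_op Y e]eY mul1mx.
  by case/eqP: (nnY N); rewrite -opz -AY AN0 linear0.
have e_f : e = f by apply/eqP; rewrite -subr_eq0 ef0.
have : gring_op X z *m gring_op X B = 1%:M.
  by rewrite -[LHS]mul1mx -{1}eX mulmxA -!gring_opM // -/A -/f -e_f.
by rewrite -opz => /mulmx1_unit[].
Qed.

(** Transitivity of the relative trace, where the trace from H to G of the
    G-endomorphism K is the index of H times K. *)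
Lemma trace_from_odd_index (E : representation F G) (H : {group gT})
    (K D : 'M_(rdegree E)) :
    H \subset G -> (#|G : H|%g)%:R != 0 :> F ->
    (forall x, x \in G -> K *m E x = E x *m K) ->
    K = \sum_(p in H) E p^-1%g *m D *m E p ->
  exists D', K = \sum_(g in G) E g^-1%g *m D' *m E g.
Proof.
move=> sHG nzi cK DK; exists ((#|G : H|%g)%:R^-1 *: D).
rewrite (set_partition_big _ (rcosets_partition sHG)) /=.
transitivity (\sum_(A in rcosets H G) (#|G : H|%g)%:R^-1 *: K).
  by rewrite sumr_const -/(indexg _ _) -scaler_nat scalerA mulfV // scale1r.
apply: eq_bigr => _ /rcosetsP[r Gr ->].
transitivity ((#|G : H|%g)%:R^-1 *: (E r^-1%g *m K *m E r)).
  by rewrite -mulmxA cK // mulmxA -repr_mxM ?groupV // mulVg repr_mx1 mul1mx.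
rewrite DK mulmx_sumr mulmx_suml scaler_sumr.
rewrite [RHS](reindex_inj (mulIg r)) /=.
under [RHS]eq_bigl => p do rewrite mem_rcoset mulgK.
apply: eq_bigr => p Hp; have Gp := subsetP sHG p Hp.
rewrite invMg !repr_mxM ?groupV // -scalemxAr -scalemxAl.
by rewrite !mulmxA.
Qed.

(** The hypotheses say that M, restricted to H, is the sum of a trivial module
    spanned by v and a projective one: by Higman, projectivity of the kernel of
    l is the trace formula for the projection 1 - l v. The module of
    endomorphisms splits as k plus the kernel of the trace map, and the
    projection on that kernel is again a trace from the trivial subgroup. *)
Lemma endo_trivial_criterion (M : representation F G) (H : {group gT})
    (v : 'rV_(rdegree M)) (l : 'cV_(rdegree M)) (D : 'M_(rdegree M)) :
    H \subset G -> #|H|%:R = 0 :> F -> (#|G : H|%g)%:R != 0 :> F ->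
    (forall p, p \in H -> v *m M p = v) ->
    (forall p, p \in H -> M p *m l = l) ->
    v *m l = 1%:M ->
    1%:M - l *m v = \sum_(p in H) M p^-1%g *m D *m M p ->
  endo_trivial M.
Proof.
move=> sHG H0 nzi vH lH vl trD; set n := rdegree M in v l D vH lH vl trD *.
pose E := end_grepr M.
have actE (A : 'M[F]_n) x : mxvec A *m E x = mxvec (M x^-1%g *m A *m M x).
  by rewrite /= /end_mx mulmxA !mul_vec_lin.
pose b : 'M[F]_(rdegree E, 1) := \col_i \tr (vec_mx (delta_mx 0 i) : 'M[F]_n).
have vecb (A : 'M[F]_n) : mxvec A *m b = (\tr A)%:M.
  apply/matrixP => i j; rewrite !ord1 !mxE eqxx mulr1n.
  rewrite -{2}[A]mxvecK [in RHS](row_sum_delta (mxvec A)) !linear_sum.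
  by apply: eq_bigr => h _; rewrite /= !linearZ /= mxE.
pose a : 'M[F]_(1, rdegree E) := mxvec (1%:M : 'M_n).
have eqc m (B C : 'M[F]_(rdegree E, m)) :
    (forall A : 'M[F]_n, mxvec A *m B = mxvec A *m C) -> B = C.
  move=> eBC; apply/row_matrixP=> i; rewrite !rowE.
  by rewrite -[delta_mx 0 i]vec_mxK.
have trl : \tr (l *m v) = 1 by rewrite mxtrace_mulC vl mxtrace1.
have n1 : n%:R = 1 :> F.
  rewrite -(mxtrace1 F n) -[1%:M](subrK (l *m v)) linearD /= trl trD linear_sum.
  rewrite (eq_bigr (fun=> \tr D)) => [|p Hp] /=.
    by rewrite sumr_const -mulr_natl H0 mul0r add0r.
  rewrite mxtrace_mulC mulmxA -repr_mxM ?groupV ?(subsetP sHG) //.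
  by rewrite mulgV repr_mx1 mul1mx.
have ab : a *m b = 1%:M by rewrite vecb mxtrace1 n1.
pose S := triv_grepr F G.
have ha x : x \in G -> S x *m a = a *m E x.
  move=> Gx; rewrite /= mul1mx [RHS]actE mulmx1 -repr_mxM ?groupV //.
  by rewrite mulVg repr_mx1.
have hb x : x \in G -> E x *m b = b *m S x.
  move=> Gx; apply: eqc => A; rewrite mulmxA actE /= mulmx1 !vecb.
  by rewrite mxtrace_mulC mulmxA -repr_mxM ?groupV // mulgV repr_mx1 mul1mx.
have [Q [c [d [simE hc hd cd dc]]]] := split_summand (R := E) (S := S) ha hb ab.
exists Q; split=> //.
(* Write h = l v, a projection of rank 1, and p = 1 - h. As h A h = tr(h A) h,
   the projection A - tr(A) 1 of A on the trace zero matrices equals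
   h A p + p A - tr(p A) h - tr(A) p. This is linear in p, which is a trace
   over H while h commutes with H; so D0 is obtained by putting D for p. *)
pose D0 : 'M[F]_(rdegree E) :=
  lin_mx (mulmx (l *m v)) *m lin_mx (mulmxr D) + lin_mx (mulmx D)
    - lin_mx (mulmx D) *m b *m mxvec (l *m v) - b *m mxvec D.
have actD0 A : mxvec A *m D0 =
    mxvec (l *m v *m A *m D + D *m A - \tr (D *m A) *: (l *m v) - \tr A *: D).
  rewrite /D0 !mulmxBr mulmxDr !mulmxA !mul_vec_lin /= !vecb !mul_scalar_mx.
  by rewrite !linearB linearD /= !linearZ.
have cK x : x \in G -> (1%:M - b *m a) *m E x = E x *m (1%:M - b *m a).
  move=> Gx; rewrite mulmxBl mulmxBr mul1mx mulmx1 -[b *m a *m _]mulmxA.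
  by rewrite -ha // mulmxA -hb // mulmxA.
have trK : 1%:M - b *m a = \sum_(p in H) E p^-1%g *m D0 *m E p.
  apply: eqc => A; rewrite mulmx_sumr.
  transitivity (mxvec (\sum_(p in H)
     (l *m v *m A *m (M p^-1%g *m D *m M p) + (M p^-1%g *m D *m M p) *m A
      - \tr ((M p^-1%g *m D *m M p) *m A) *: (l *m v)
      - \tr A *: (M p^-1%g *m D *m M p)))).
    rewrite mulmxBr mulmx1 mulmxA vecb mul_scalar_mx -linearZ -linearB /=.
    congr mxvec; rewrite !big_split /= !sumrN.
    rewrite -mulmx_sumr -mulmx_suml -scaler_sumr -scaler_suml.
    rewrite -raddf_sum /= -mulmx_suml -trD.
    rewrite mulmxBr mulmx1 mulmxBl mul1mx linearB /=.
    have -> : l *m v *m A *m (l *m v) = \tr (l *m v *m A) *: (l *m v).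
      rewrite -!mulmxA mxtrace_mulC !mulmxA -(mulmxA l) -(mulmxA l).
      rewrite [v *m A *m l]mx11_scalar mxtrace_scalar mulr1n.
      by rewrite mul_mx_scalar scalemxAl.
    move: (l *m v) => Y; move: (Y *m A) => X; move: (\tr A) (\tr X) => s t.
    by apply/matrixP => i j; rewrite !mxE; ring.
  rewrite linear_sum; apply: eq_bigr => p Hp.
  have Gp := subsetP sHG p Hp.
  have lpV : M p^-1%g *m l = l by rewrite lH ?groupV.
  rewrite /= [RHS]mulmxA [X in _ = X *m _]mulmxA actE actD0 actE; congr mxvec.
  rewrite invgK !(mulmxDr, mulmxDl, mulmxN, mulNmx) -!scalemxAr -!scalemxAl.
  have cpp (X : 'M[F]_n) : X *m M p^-1%g *m M p = X.
    by rewrite -mulmxA -repr_mxM ?groupV // mulVg repr_mx1 mulmx1.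
  congr (_ + _ + _ + _); first 1 last.
  - by rewrite !mulmxA cpp.
  - rewrite !mulmxA lpV -(mulmxA l) vH //; congr (- (_ *: _)).
    by rewrite [RHS]mxtrace_mulC !mulmxA.
  - congr (- (_ *: _)); rewrite mxtrace_mulC mulmxA -repr_mxM ?groupV //.
    by rewrite mulVg repr_mx1 mul1mx.
  by rewrite !mulmxA lpV -(mulmxA l v (M p)) vH.
have [D' DK] := trace_from_odd_index sHG nzi cK trK.
apply: (higman_projective (Q := Q) (D := c *m D' *m d)).
have -> : (1%:M : 'M_(rdegree Q)) = c *m (d *m c) *m d by rewrite mulmxA cd mul1mx.
rewrite dc DK mulmx_sumr mulmx_suml; apply: eq_bigr => g Gg.
have assoc (X1 : 'M[F]_(rdegree Q, rdegree E)) (X2 X3 X4 : 'M[F]_(rdegree E))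
    (X5 : 'M[F]_(rdegree E, rdegree Q)) :
  X1 *m (X2 *m X3 *m X4) *m X5 = (X1 *m X2) *m X3 *m (X4 *m X5).
  by rewrite !mulmxA.
by rewrite assoc -hc ?groupV // hd // !mulmxA.
Qed.
End Modules.

(** * Fixed points and relative traces under a Klein four group *)

(** For S an additive property, the sum of f over a stable set agrees modulo S
    with the sum over the fixed points, provided the sum over each nontrivial
    orbit has S. This is what makes the Brauer quotient functor compute with
    fixed points. *)
Lemma sum_off_fixed (aT : finGroupType) (H : {group aT}) (T : finType)
    (to : {action aT &-> T}) (A : {set T}) (V : zmodType) (S : V -> Prop)
    (f : T -> V) :
    S 0 -> (forall x y, S x -> S y -> S (x + y)) ->
    [acts H, on A | to] ->
    (forall i, i \in A -> i \notin 'Fix_to(H)%g -> S (\sum_(j in orbit to H i) f j)) ->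
  S (\sum_(i in A) f i - \sum_(i in 'Fix_(A | to)(H)%g) f i).
Proof.
move=> S0 SD actA Sorb.
rewrite (big_setID (afix to H)) /= addrAC subrr add0r.
have actB : [acts H, on A :\: 'Fix_to(H)%g | to].
  apply/actsP => a Ha x; rewrite !in_setD (actsP actA) //; congr (~~ _ && _).
  apply/afixP/afixP => fx b Hb; last by rewrite !fx.
  have e : to x a = x by rewrite -[RHS](actK to a) fx ?groupV.
  by rewrite -{1}e fx.
rewrite (set_partition_big _ (orbit_partition actB)) /=.
by apply: big_ind => // _ /imsetP[i /setDP[Ai nFi] ->]; apply: Sorb.
Qed.

Lemma klein_sum (gT : finGroupType) (P : {group gT}) u w (V : zmodType)
    (f : gT -> V) :
  klein_four P -> u \in P -> w \in P -> u != 1%g -> w != 1%g -> w != u ->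
  \sum_(p in P) f p = f 1%g + f u + f w + f (u * w)%g.
Proof.
move=> kP Pu Pw u1 w1 wu.
have [defP un] := klein_elements kP Pu Pw u1 w1 wu.
rewrite (eq_bigl [in [:: 1; u; w; u * w]%g]) => [|p]; last first.
  by rewrite defP !inE -!orbA.
by rewrite -big_uniq //= !big_cons big_nil addr0 !addrA.
Qed.

(** On the kernel of l the square zero map D is exact, and an exact complex of
    vector spaces is contractible; D vanishes on v. *)
Lemma exact_contraction (F : fieldType) n (D : 'M[F]_n) (v : 'rV_n) (l : 'cV_n) :
    D *m D = 0 -> v *m D = 0 -> D *m l = 0 -> v *m l = 1%:M ->
    (kermx D <= D + v)%MS ->
  exists X, D *m X + X *m D = 1%:M - l *m v.
Proof.
move=> DD vD Dl vl kD; set pi := 1%:M - l *m v.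
have [X0 DXD] : exists X0, D *m X0 *m D = D by exists (pinvmx D); rewrite mulmxKpV.
have piD : pi *m D = D by rewrite mulmxBl mul1mx -mulmxA vD mulmx0 subr0.
have Dpi : D *m pi = D by rewrite mulmxBr mulmx1 mulmxA Dl mul0mx subr0.
have vpi : v *m pi = 0 by rewrite mulmxBr mulmx1 mulmxA vl mul1mx subrr.
clearbody pi; pose K := 1%:M - D *m X0.
have KD : K *m D = 0 by rewrite mulmxBl mul1mx DXD subrr.
have key : K *m pi *m (1%:M - X0 *m D) = 0.
  have : (K <= D + v)%MS by apply: submx_trans kD; rewrite sub_kermx KD.
  case/sub_addsmxP=> -[a b] /= ->.
  rewrite [_ *m pi]mulmxDl -!(mulmxA _ _ pi) Dpi vpi mulmx0 addr0 -mulmxA.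
  by rewrite mulmxBr mulmx1 mulmxA DXD subrr mulmx0.
have keyE : pi = D *m X0 *m pi + pi *m X0 *m D - D *m X0 *m pi *m X0 *m D.
  move: key; rewrite mulmxBr mulmx1 /K !mulmxBl mul1mx !mulmxA => /eqP.
  rewrite subr_eq0 => /eqP e; rewrite -[LHS](subrK (D *m X0 *m pi)) e.
  by rewrite addrC addrA.
(* In keyE the outer terms have the form D Y and Y D up to the factor pi, which D
   absorbs; the last one is D Y with Y = X0 pi X0 D, and Y D = 0. *)
exists (pi *m X0 *m pi - X0 *m pi *m X0 *m D).
rewrite mulmxBr mulmxBl !mulmxA Dpi -!mulmxA DD !mulmx0 subr0 piD !mulmxA.
by rewrite [RHS]keyE addrAC.
Qed.

(** The coefficients of the sum of lam(x^-1) x over the elements x of odd order of a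
    group, for a linear character lam. This central element restricts well: its
    part supported on a subgroup with a normal 2-complement O is the sum of
    lam(x^-1) x over O. *)
Definition odd_order_weight (F : fieldType) (gT : finGroupType) (lam : gT -> F) x :=
  if odd #[x]%g then lam x^-1%g else 0.

Lemma odd_order_weightJ (F : fieldType) (gT : finGroupType) (G : {group gT})
    (lam : gT -> F) :
    {in G &, forall x y, lam (x * y)%g = lam x * lam y} -> lam 1%g = 1 ->
  {in G &, forall x g, odd_order_weight lam (x ^ g)%g = odd_order_weight lam x}.
Proof.
move=> lamM lam1 x g Gx Gg; rewrite /odd_order_weight orderJ; case: odd => //.
rewrite -conjVg conjgE !lamM ?groupM ?groupV //.
by rewrite mulrC -mulrA [lam g * _]mulrC -lamM ?groupV // mulVg lam1 mulr1.
Qed.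

Section Core.

Variables (F : fieldType) (gT : finGroupType) (G P : {group gT}) (n : nat).
Variable rG : mx_representation F G n.
Hypotheses (ch2 : 2%N \in [pchar F]) (sylP : (2.-Sylow(G) P)%g) (kP : klein_four P).

Let sPG : P \subset G. Proof. exact: pHall_sub sylP. Qed.
Let PG x : x \in P -> x \in G. Proof. exact: subsetP. Qed.
Let sqP x : x \in P -> (x * x = 1)%g. Proof. by case: kP => _ _; apply. Qed.
Let Pinv x : x \in P -> (x^-1 = x)%g. Proof. exact: klein_inv. Qed.
Let addmm p q (A : 'M[F]_(p, q)) : A + A = 0.
Proof. by apply/matrixP => i j; rewrite !mxE addrr_pchar2. Qed.
Let oppmm p q (A : 'M[F]_(p, q)) : - A = A.
Proof. by apply/matrixP => i j; rewrite !mxE oppr_pchar2. Qed.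

Definition conj_mx (A : 'M[F]_n) x := rG x^-1%g *m A *m rG x.

Lemma conj_mxD A B x : conj_mx (A + B) x = conj_mx A x + conj_mx B x.
Proof. by rewrite /conj_mx mulmxDr mulmxDl. Qed.

Lemma conj_mxM A x y : x \in G -> y \in G ->
  conj_mx A (x * y) = conj_mx (conj_mx A x) y.
Proof.
by move=> Gx Gy; rewrite /conj_mx invMg !repr_mxM ?groupV // !mulmxA.
Qed.

Lemma conj_mx_id A x : x \in G -> A *m rG x = rG x *m A -> conj_mx A x = A.
Proof.
move=> Gx cA; rewrite /conj_mx -mulmxA cA mulmxA -repr_mxM ?groupV //.
by rewrite mulVg repr_mx1 mul1mx.
Qed.

Lemma conj_mx_comm A x : x \in G -> conj_mx A x = A -> A *m rG x = rG x *m A.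
Proof.
move=> Gx cA; rewrite -{2}cA /conj_mx !mulmxA -repr_mxM ?groupV //.
by rewrite mulgV repr_mx1 mul1mx.
Qed.

Definition comm_on (H : {group gT}) (A : 'M[F]_n) :=
  forall x, x \in H -> A *m rG x = rG x *m A.

(** The ideal generated by the relative traces from proper subgroups of P in the
    algebra of P-endomorphisms. A trace from the trivial subgroup is also one
    from a subgroup of order 2, and A + A^w is the trace of A from the subgroup
    generated by u when w lies outside it, and 0 otherwise. *)
Inductive proper_trace : 'M[F]_n -> Prop :=
| proper_trace0 : proper_trace 0
| proper_traceD A B : proper_trace A -> proper_trace B -> proper_trace (A + B)
| proper_trace_step u w A : u \in P -> u != 1%g -> w \in P ->
    A *m rG u = rG u *m A -> proper_trace (A + conj_mx A w).
Local Notation J := proper_trace.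

Lemma proper_traceMl A B : comm_on P A -> J B -> J (A *m B).
Proof.
move=> cA; elim=> [|B1 B2 _ IH1 _ IH2 | u w C Pu u1 Pw cC].
- by rewrite mulmx0; apply: proper_trace0.
- by rewrite mulmxDr; apply: proper_traceD.
have -> : A *m (C + conj_mx C w) = A *m C + conj_mx (A *m C) w.
  by rewrite mulmxDr /conj_mx !mulmxA cA ?groupV.
by apply: (proper_trace_step Pu u1 Pw); rewrite -mulmxA cC !mulmxA cA.
Qed.

Lemma proper_traceMr A B : comm_on P A -> J B -> J (B *m A).
Proof.
move=> cA; elim=> [|B1 B2 _ IH1 _ IH2 | u w C Pu u1 Pw cC].
- by rewrite mul0mx; apply: proper_trace0.
- by rewrite mulmxDl; apply: proper_traceD.
have -> : (C + conj_mx C w) *m A = C *m A + conj_mx (C *m A) w.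
  by rewrite mulmxDl /conj_mx -!mulmxA -cA.
by apply: (proper_trace_step Pu u1 Pw); rewrite -mulmxA cA // mulmxA cC mulmxA.
Qed.

(** The functional sending B to v B l takes on a proper trace a value which is
    divisible by 2. *)
Lemma proper_trace_fixed (v : 'rV_n) (l : 'cV_n) B :
    (forall p, p \in P -> v *m rG p = v) -> (forall p, p \in P -> rG p *m l = l) ->
  J B -> v *m B *m l = 0.
Proof.
move=> vP lP; elim=> [|B1 B2 _ IH1 _ IH2 | u w C Pu u1 Pw cC].
- by rewrite mulmx0 mul0mx.
- by rewrite mulmxDr mulmxDl IH1 IH2 addr0.
rewrite /conj_mx mulmxDr mulmxDl !mulmxA vP ?groupV //.
by rewrite -[v *m C *m rG w *m l]mulmxA lP // addmm.
Qed.

(** Mackey's formula modulo proper traces: a nontrivial P-orbit contributes a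
    trace from the stabiliser of one of its points. *)
Lemma sum_mod_proper_trace (T : finType) (to : {action gT &-> T}) (A : {set T})
    (f : T -> 'M[F]_n) :
    [acts P, on A | to] ->
    {in A & P, forall i p, f (to i p) = conj_mx (f i) p} ->
  J (\sum_(i in A) f i - \sum_(i in 'Fix_(A | to)(P)%g) f i).
Proof.
move=> actA fJ; apply: sum_off_fixed => //; [exact: proper_trace0 | exact: proper_traceD |].
move=> i Ai nFi.
have Af p : p \in P -> f (to i p) = conj_mx (f i) p by move=> Pp; apply: fJ.
(* The stabiliser is either of order 2, generated by u, or trivial. *)
have [/exists_inP[u Pu /andP[u1 /eqP fu]] | free] :=
    boolP [exists (u | u \in P), (u != 1%g) && (to i u == i)].
  have [w [Pw w1 wu]] := klein_other kP Pu.
  have [defP _] := klein_elements kP Pu Pw u1 w1 wu.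
  have nfw : to i w != i.
    apply: contraNneq nFi => fw; apply/afixP => x.
    rewrite defP !inE -!orbA => /or4P[] /eqP-> //; first exact: act1.
    by rewrite actM fu.
  have -> : orbit to P i = i |: [set to i w].
    rewrite /orbit defP; apply/setP => j; rewrite !inE; apply/imsetP/idP.
      case=> x; rewrite !inE -!orbA => /or4P[] /eqP-> ->;
      by rewrite ?act1 ?actM ?fu eqxx ?orbT.
    by case/orP=> /eqP->; [exists u | exists w]; rewrite ?fu ?inE ?eqxx ?orbT.
  rewrite big_setU1 ?big_set1 ?inE 1?eq_sym //= Af //.
  apply: (proper_trace_step Pu u1 Pw); apply: conj_mx_comm; rewrite ?PG //.
  by rewrite -Af // fu.
have [u [Pu u1 _]] := klein_other kP (group1 P).
have [w [Pw w1 wu]] := klein_other kP Pu.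
rewrite big_imset /= => [|x y Px Py exy]; last first.
  apply/eqP; rewrite eq_mulgV1; apply: contraR free => nxy.
  apply/exists_inP; exists (x * y^-1)%g; first by rewrite groupM ?groupV.
  by rewrite nxy actM exy actK /=.
rewrite (klein_sum _ kP Pu Pw u1 w1 wu) act1 !Af ?groupM // conj_mxM ?PG //.
rewrite -addrA -conj_mxD; apply: (proper_trace_step Pu u1 Pw).
apply: conj_mx_comm; rewrite ?PG // conj_mxD -conj_mxM ?PG // sqP //.
by rewrite addrC /conj_mx invg1 repr_mx1 mulmx1 mul1mx.
Qed.

Section Invol.
Variable u : gT.
Hypothesis Pu : u \in P.
Let Gu : u \in G := PG Pu.
Let D := rG u - 1%:M.

Lemma invol_sq : rG u *m rG u = 1%:M.
Proof. by rewrite -repr_mxM // sqP // repr_mx1. Qed.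

(** In characteristic 2, the quotient of the kernel of u - 1 by its image D is the
    Brauer quotient of the module at the subgroup generated by u; an orbit of
    length 2 contributes m + m u, which lies in the image. *)
Lemma sum_mod_image (T : finType) (to : {action gT &-> T}) (A : {set T})
    (f : T -> 'rV[F]_n) :
    [acts <[u]>%g, on A | to] -> {in A, forall i, f (to i u) = f i *m rG u} ->
  (\sum_(i in A) f i - \sum_(i in 'Fix_(A | to)[u]%g) f i <= D)%MS.
Proof.
move=> actA fu; have -> : 'Fix_(A | to)[u]%g = 'Fix_(A | to)(<[u]>)%g.
  by rewrite afix_cycle.
apply: (sum_off_fixed (S := fun v : 'rV_n => (v <= D)%MS)) => //.
- exact: sub0mx.
- by move=> x y; apply: addmx_sub.
move=> i Ai nFi; rewrite afix_cycle in nFi.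
have nfi : to i u != i by apply: contra nFi => /eqP fi; apply/afix1P.
have uu : (u ^+ 2 = 1)%g by rewrite expgS expg1 sqP.
have -> : orbit to <[u]>%g i = i |: [set to i u].
  apply/setP => j; rewrite !inE; apply/imsetP/orP.
    case=> _ /cycleP[k ->] ->; rewrite -(expg_mod _ uu) modn2.
    by case: (odd k); rewrite ?expg1 ?expg0 ?act1 eqxx; auto.
  by case=> /eqP->; [exists 1%g; rewrite ?act1 ?group1 | exists u; rewrite ?cycle_id].
rewrite big_setU1 ?big_set1 ?inE 1?eq_sym //= fu //.
have -> : f i + f i *m rG u = f i *m D.
  by rewrite /D mulmxBr mulmx1 oppmm addrC.
exact: submxMl.
Qed.

Lemma image_cent_stable m (A : 'M_(m, n)) x : x \in 'C_G[u]%g ->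
  (A <= D)%MS -> (A *m rG x <= D)%MS.
Proof.
case/setIP=> Gx /cent1P cx /submxP[B ->].
have -> : B *m D *m rG x = B *m rG x *m D.
  by rewrite /D !mulmxBr !mulmxBl !mulmx1 -!mulmxA -!repr_mxM // cx.
exact: submxMl.
Qed.

Lemma fixed_kernel (m : 'rV_n) : (m <= kermx D)%MS = (m *m rG u == m).
Proof.
by rewrite sub_kermx /D mulmxBr mulmx1 subr_eq0.
Qed.

(** The Brauer homomorphism at u: a central element acts on the Brauer quotient
    as its part supported on the centraliser of u. *)
Lemma central_mod_image (c : gT -> F) (m : 'rV_n) :
    {in G &, forall x g, c (x ^ g)%g = c x} -> m *m rG u = m ->
  (m *m (\sum_(x in G) c x *: rG x) - m *m (\sum_(x in 'C_G[u]%g) c x *: rG x) <= D)%MS.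
Proof.
move=> cJ mu; rewrite !mulmx_sumr.
have -> : 'C_G[u]%g = 'Fix_(G | 'J)[u]%g.
  apply/setP => x; rewrite !in_setI; congr (_ && _).
  by apply/cent1P/afix1P => /= [cx | /conjg_fixP/commgP //]; apply/conjg_fixP/commgP.
apply: (sum_mod_image (to := 'J%act)) => [|x Gx].
  by rewrite cycle_subG; apply/astabsP => x; rewrite /= memJ_norm // (subsetP (normG G)).
rewrite /= cJ // -!scalemxAr -scalemxAl /conjg !repr_mxM ?groupM ?groupV //.
by rewrite Pinv // !mulmxA mu.
Qed.

End Invol.

(** The Brauer homomorphism at P. *)
Lemma central_mod_proper_trace (c : gT -> F) :
    {in G &, forall x g, c (x ^ g)%g = c x} ->
  J (\sum_(x in G) c x *: rG x - \sum_(x in 'C_G(P)%g) c x *: rG x).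
Proof.
move=> cJ; rewrite -afixJ.
apply: (sum_mod_proper_trace (to := 'J%act)) => [|x p Gx Pp].
  apply/subsetP => p Pp; apply/astabsP => x.
  by rewrite /= memJ_norm // (subsetP (normG G)) ?PG.
have Gp := PG Pp.
rewrite /= cJ // /conj_mx -scalemxAr -scalemxAl /conjg !repr_mxM ?groupM ?groupV //.
by rewrite !mulmxA.
Qed.

Lemma central_comm (c : gT -> F) :
    {in G &, forall x g, c (x ^ g)%g = c x} ->
  comm_on G (\sum_(x in G) c x *: rG x).
Proof.
move=> cJ x Gx; rewrite mulmx_sumr mulmx_suml [RHS](reindex_acts 'J _ Gx) /=; last first.
  by rewrite astabsJ normG.
apply: eq_bigr => y Gy; rewrite -scalemxAl -scalemxAr cJ //.
by rewrite -!repr_mxM ?groupJ // -conjgC.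
Qed.

Local Notation N := 'N_G(P)%g.

(** P is the only Sylow 2-subgroup of its normaliser. *)
Lemma normalizer_invol x : x \in N -> (x * x = 1)%g -> x \in P.
Proof.
move=> Nx xx; have nP : (P <| N)%g by rewrite normalSG.
have sylN : (2.-Sylow(N) P)%g := pHall_subl (normal_sub nP) (subsetIl _ _) sylP.
rewrite (mem_normal_Hall sylN nP) // /p_elt.
have : (#[x]%g %| 2)%N by rewrite order_dvdn expgS expg1 xx.
by case/primeP: (isT : prime 2) => _ /[apply] /orP[] /eqP->.
Qed.

(** The relative trace from N to G. The representatives chosen do not matter when
    phi commutes with N. *)
Definition coset_trace phi : 'M[F]_n :=
  \sum_(A in rcosets N G) conj_mx phi (repr A).

Lemma conj_mx_coset phi g : comm_on N%G phi -> g \in G ->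
  conj_mx phi (repr (N :* g)%g) = conj_mx phi g.
Proof.
move=> cphi Gg; have /rcosetP[x Nx ->] := mem_repr_rcoset N%G g.
have Gx : x \in G by case/setIP: Nx.
by rewrite conj_mxM // (conj_mx_id _ (cphi x Nx)).
Qed.

Lemma coset_trace_equivariant phi g : comm_on N%G phi -> g \in G ->
  {in rcosets N G, forall A, conj_mx phi (repr ('Rs%act A g)) =
                             conj_mx (conj_mx phi (repr A)) g}.
Proof.
move=> cphi Gg _ /rcosetsP[h Gh ->].
by rewrite /= !rcosetE -rcosetM !conj_mx_coset ?groupM // conj_mxM.
Qed.

(** P fixes no coset of N other than N itself. *)
Lemma coset_trace_mod phi : comm_on N%G phi -> J (coset_trace phi - phi).
Proof.
move=> cphi.
have actN : [acts P, on rcosets N G | 'Rs].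
  exact: subset_trans sPG (actsRs_rcosets _ _).
have := sum_mod_proper_trace actN
  (fun A p RA Pp => coset_trace_equivariant cphi (PG Pp) RA).
suff -> : 'Fix_(rcosets N G | 'Rs)(P)%g = [set N].
  rewrite big_set1 -[in repr _](rcoset1 N) conj_mx_coset //.
  by rewrite /conj_mx invg1 repr_mx1 mulmx1 mul1mx.
have sPN : P \subset N by rewrite subsetI sPG normG.
apply/setP => A; rewrite in_setI in_set1; apply/andP/eqP => [[] | ->]; last first.
  split; first by apply/rcosetsP; exists 1%g; rewrite ?rcoset1.
  by apply/afixP => p Pp; rewrite /= rcosetE rcoset_id // (subsetP sPN).
case/rcosetsP=> g Gg -> /afixP fixg; apply: rcoset_id.
rewrite -groupV inE groupV Gg /= inE; apply/subsetP => _ /imsetP[p Pp ->].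
apply: normalizer_invol; last by rewrite -conjMg sqP ?conj1g.
have := fixg p Pp; rewrite /= rcosetE -rcosetM => /rcoset_eqP.
by rewrite mem_rcoset conjgE invgK mulgA.
Qed.

Lemma coset_trace_comm phi : comm_on N%G phi -> comm_on G (coset_trace phi).
Proof.
move=> cphi g Gg; apply: conj_mx_comm => //.
rewrite {2}/coset_trace (reindex_acts 'Rs (actsRs_rcosets _ _) Gg) /=.
rewrite /conj_mx mulmx_sumr mulmx_suml; apply: eq_bigr => A RA.
by rewrite -[RHS]/(conj_mx phi (repr ('Rs%act A g))) coset_trace_equivariant.
Qed.

Lemma subrXX_proper_trace (A E : 'M[F]_n) i : comm_on P A -> comm_on P E -> E *m E = E ->
  J (A - E) -> J (A ^+ i.+1 - E).
Proof.
move=> cA cE EE JAE; elim: i => [|i IH]; first by rewrite expr1.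
have -> : A ^+ i.+2 - E = A *m (A ^+ i.+1 - E) + (A - E) *m E.
  by rewrite exprS -mulmxE mulmxBr mulmxBl EE addrA subrK.
by apply: proper_traceD; [apply: proper_traceMl | apply: proper_traceMr].
Qed.

(** The vector v0 spans a copy of a linear module with character chi inside the
    restriction to N, and l is a retraction on it. *)
Section Source.

Variables (chi : gT -> F) (v0 : 'rV[F]_n) (l : 'cV[F]_n).
Hypotheses (v0N : forall x, x \in N -> v0 *m rG x = chi x *: v0).
Hypotheses (lN : forall x, x \in N -> rG x *m l = chi x *: l).
Hypothesis v0l : v0 *m l = 1%:M.
Hypothesis local_end : forall A, comm_on G A ->
  (exists i : nat, A ^+ i = 0) \/ A \in unitmx.

Let sPN : P \subset N. Proof. by rewrite subsetI sPG normG. Qed.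

(** An involution has only the eigenvalue 1 in characteristic 2. *)
Lemma chi_klein p : p \in P -> chi p = 1.
Proof.
move=> Pp; have Np := subsetP sPN p Pp.
have : v0 *m rG p *m rG p *m l = 1%:M.
  by rewrite -(mulmxA v0) -repr_mxM ?PG // sqP // repr_mx1 mulmx1.
rewrite v0N // -scalemxAl v0N // -!scalemxAl v0l scalerA => /matrixP/(_ 0 0).
rewrite !mxE /= mulr1 => /eqP; rewrite -expr2 sqrf_eq1 oppr_pchar2 //.
by rewrite orbb => /eqP.
Qed.

Lemma functional_fixed p : p \in P -> rG p *m l = l.
Proof. by move=> Pp; rewrite lN ?(subsetP sPN) // chi_klein ?scale1r. Qed.

Lemma vector_fixed p : p \in P -> v0 *m rG p = v0.
Proof. by move=> Pp; rewrite v0N ?(subsetP sPN) // chi_klein ?scale1r. Qed.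

Lemma mul_lv_comm (v : 'rV_n) : (forall x, x \in N -> v *m rG x = chi x *: v) ->
  comm_on N%G (l *m v).
Proof.
move=> vN x Nx; rewrite -mulmxA vN // mulmxA lN //.
by rewrite -scalemxAr -scalemxAl.
Qed.

(** Modulo proper traces A is an idempotent which is the identity on v0, so no
    power of A vanishes; a G-endomorphism which is not nilpotent is invertible. *)
Lemma unit_of_proper_trace (A : 'M[F]_n) (E : 'M[F]_n) : comm_on G A ->
  comm_on P E -> E *m E = E -> v0 *m E = v0 -> J (A - E) -> A \in unitmx.
Proof.
move=> cA cE EE vE JAE; have [[i Ai0]|//] := local_end cA.
have cAP : comm_on P A by move=> x /PG; apply: cA.
have := proper_trace_fixed vector_fixed functional_fixed
  (subrXX_proper_trace i cAP cE EE JAE).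
rewrite exprS Ai0 mulr0 sub0r mulmxN mulNmx vE v0l => /matrixP/(_ 0 0)/eqP.
by rewrite !mxE oppr_eq0 oner_eq0.
Qed.

(** The Green correspondence for linear modules. The trace theta of the projection
    l v0 is congruent to l v0 modulo proper traces, hence invertible; with
    v = v0 theta^-1 the trace of l v is the identity. So M is a summand of the
    module induced from the linear N-module, and M is generated by v. *)
Lemma trivial_source_decomposition :
  exists v : 'rV_n,
    [/\ forall x, x \in N -> v *m rG x = chi x *: v, v *m l = 1%:M,
        coset_trace (l *m v) = 1%:M & J (1%:M - l *m v)].
Proof.
have cE := mul_lv_comm v0N; set E := l *m v0 in cE.
have cEP : comm_on P E by move=> x /(subsetP sPN); apply: cE.
have EE : E *m E = E by rewrite /E -mulmxA (mulmxA v0) v0l mul1mx.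
have cT := coset_trace_comm cE; have JT := coset_trace_mod cE.
have uT : coset_trace E \in unitmx.
  by apply: (unit_of_proper_trace cT cEP EE _ JT); rewrite /E mulmxA v0l mul1mx.
pose T' := invmx (coset_trace E).
have cT' x : x \in G -> T' *m rG x = rG x *m T'.
  move=> Gx; apply: (canRL (mulmxK uT)); rewrite -mulmxA -cT // mulmxA mulVmx //.
  by rewrite mul1mx.
pose v := v0 *m T'.
have vN x : x \in N -> v *m rG x = chi x *: v.
  by move=> Nx; have /setIP[Gx _] := Nx; rewrite -mulmxA cT' // mulmxA v0N // -scalemxAl.
have Tv : coset_trace (l *m v) = 1%:M.
  rewrite -(mulmxV uT) /coset_trace mulmx_suml; apply: eq_bigr => A /rcosetsP[g Gg ->].
  rewrite !conj_mx_coset //; last exact: mul_lv_comm.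
  by rewrite /conj_mx -!mulmxA cT'.
have Jv : J (1%:M - l *m v) by rewrite -Tv; apply: coset_trace_mod; apply: mul_lv_comm.
exists v; split=> //.
have := proper_trace_fixed vector_fixed functional_fixed Jv.
rewrite mulmxBr mulmx1 mulmxBl v0l mulmxA v0l mul1mx => /eqP.
by rewrite subr_eq0 => /eqP.
Qed.

End Source.

Section Decomposed.

Variables (chi : gT -> F) (v : 'rV[F]_n) (l : 'cV[F]_n).
Hypotheses (vN : forall x, x \in N -> v *m rG x = chi x *: v).
Hypotheses (lN : forall x, x \in N -> rG x *m l = chi x *: l).
Hypotheses (vl : v *m l = 1%:M) (Tv : coset_trace (l *m v) = 1%:M).
Hypothesis Jv : J (1%:M - l *m v).

Let vP p : p \in P -> v *m rG p = v. Proof. exact: (vector_fixed vN vl). Qed.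
Let lP' p : p \in P -> rG p *m l = l. Proof. exact: (functional_fixed vN lN vl). Qed.

Section AtInvolution.
Variable u : gT.
Hypotheses (Pu : u \in P) (u1 : u != 1%g).
Let Gu : u \in G := PG Pu.
Local Notation D := (rG u - 1%:M).
Local Notation O := ('O_(2%N)^'('C_G[u]))%g.

(** By the trace formula every m is a combination of translates of v, and if u
    fixes m then only the translates by cosets fixed by u matter modulo the
    image of u - 1. By fusion these are represented in the centraliser of u,
    that is by elements of O up to P, which fixes v. *)
Lemma ker_image_span :
  (forall x, x \in O -> (v *m rG x <= D + v)%MS) -> (kermx D <= D + v)%MS.
Proof.
move=> vO; apply/rV_subP => m; rewrite fixed_kernel => /eqP mu.
have cphi : comm_on N%G (l *m v) := mul_lv_comm lN vN.
have actN : [acts <[u]>%g, on rcosets N G | 'Rs].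
  by apply: subset_trans (actsRs_rcosets _ _); rewrite cycle_subG.
pose f A := m *m conj_mx (l *m v) (repr A).
have fE : {in rcosets N G, forall A, f ('Rs%act A u) = f A *m rG u}.
  move=> A RA; rewrite /f (coset_trace_equivariant cphi Gu RA) /conj_mx Pinv //.
  by rewrite !mulmxA mu.
have := sum_mod_image Pu actN fE.
have -> : \sum_(A in rcosets N G) f A = m by rewrite -mulmx_sumr [X in m *m X]Tv mulmx1.
set w := \sum_(i in _) _ => mwD; rewrite -(subrK w m).
apply: addmx_sub; first exact: submx_trans mwD (addsmxSl _ _).
apply: summx_sub => A /setIP[/rcosetsP[g Gg ->]] /afix1P /=.
rewrite rcosetE -rcosetM => /rcoset_eqP; rewrite mem_rcoset => Ngu.
have [|h [c [Nh Cc Dg]]] := klein_fusion sylP kP Pu Gg.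
  apply: normalizer_invol Ngu _; rewrite -!mulgA mulKg (mulgA u) sqP //.
  by rewrite mul1g mulgV.
have Gc : c \in G by case/setIP: Cc.
have -> : (N :* g = N :* c)%g by rewrite Dg rcosetM rcoset_id.
rewrite /f conj_mx_coset // /conj_mx !mulmxA -mulmxA.
apply: submx_trans (submxMl _ _) _.
have : c \in (O * P)%g by rewrite -(cent_invol_mul sylP kP Pu u1).
case/mulsgP=> o p Oo Pp Dc; have Cp := subsetP (klein_sub_cent sylP kP Pu) p Pp.
have Oo' : (o ^ p)%g \in O by rewrite O_conj.
have Go' : (o ^ p)%g \in G.
  by have /subsetP/(_ _ Oo')/setIP[] := pcore_sub (2%N)^' 'C_G[u].
by rewrite Dc conjgC (repr_mxM _ (PG Pp) Go') mulmxA vP // vO.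
Qed.

(** Away from v the module is free over the subgroup generated by u: the
    contraction X of the complex given by u - 1 turns into a trace formula for
    the endomorphism u X. *)
Lemma invol_free : (kermx D <= D + v)%MS ->
  exists d : 'M_n, 1%:M - l *m v = d + rG u *m d *m rG u.
Proof.
move=> kD; have uu := invol_sq Pu.
have DD : D *m D = 0.
  by rewrite mulmxBl !mulmxBr uu !mul1mx mulmx1 opprB addmm.
have vD : v *m D = 0 by rewrite mulmxBr vP // mulmx1 subrr.
have Dl : D *m l = 0 by rewrite mulmxBl lP' // mul1mx subrr.
have [X hX] := exact_contraction DD vD Dl vl kD.
exists (rG u *m X); rewrite (mulmxA _ _ X) uu mul1mx -hX mulmxBl mulmxBr.
by rewrite mul1mx mulmx1 !oppmm addrACA addmm addr0.
Qed.

Lemma fixed_cent (m : 'rV[F]_n) x : m *m rG u = m -> x \in 'C_G[u]%g ->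
  m *m rG x *m rG u = m *m rG x.
Proof.
move=> mu /setIP[Gx /cent1P cx].
by rewrite -mulmxA -repr_mxM // cx repr_mxM // mulmxA mu.
Qed.

Let OC x : x \in O -> x \in 'C_G[u]%g.
Proof. exact: (subsetP (pcore_sub _ _)). Qed.
Let OG x : x \in O -> x \in G.
Proof. by move/OC; case/setIP. Qed.

(** The central element acts on the Brauer quotient at u as the sum s of
    lam(x^-1) x over O, and s x = lam(x) s for x in O. If it is invertible, then
    every vector is in its image and O acts on the Brauer quotient through lam. *)
Lemma linear_block_span (lam : gT -> F) :
    {in G &, forall x y, lam (x * y)%g = lam x * lam y} -> lam 1%g = 1 ->
    \sum_(x in G) odd_order_weight lam x *: rG x \in unitmx ->
  forall x, x \in O -> (v *m rG x <= D + v)%MS.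
Proof.
move=> lamM lam1; pose c := odd_order_weight lam; set Z := \sum_(x in G) _ => uZ x Ox.
have lamV g : g \in G -> lam g^-1%g * lam g = 1.
  by move=> Gg; rewrite -lamM ?groupV // mulVg.
have cJ : {in G &, forall y g, c (y ^ g)%g = c y} := odd_order_weightJ lamM lam1.
have cZ := central_comm cJ : comm_on G Z.
pose m := v *m invmx Z.
have mu : m *m rG u = m.
  rewrite /m -[in RHS](vP Pu) -!mulmxA; congr (v *m _).
  by apply: (canRL (mulmxK uZ)); rewrite -mulmxA -cZ // mulKmx.
have mZ : m *m Z = v by rewrite mulmxKV.
have := central_mod_image Pu cJ mu; rewrite -/Z mZ; set s := \sum_(y in 'C_G[u]%g) _ => vs.
have sE : s = \sum_(y in O) lam y^-1%g *: rG y.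
  rewrite /s (bigID (fun y : gT => odd #[y]%g)) /= [X in _ + X]big1 ?addr0.
    apply: eq_big => [y|y /andP[_ oy]]; last by rewrite /c /odd_order_weight oy.
    by rewrite (cent_invol_odd sylP kP Pu u1).
  by move=> y /andP[_ /negPf ny]; rewrite /c /odd_order_weight ny scale0r.
have sx : s *m rG x = lam x *: s.
  rewrite sE mulmx_suml scaler_sumr [RHS](reindex_inj (mulIg x)) /=.
  apply: eq_big => [y|y Oy]; first by rewrite groupMr.
  rewrite -scalemxAl -repr_mxM ?OG // scalerA invMg lamM ?groupV ?OG //.
  by rewrite mulrA [lam x * _]mulrC lamV ?mul1r ?OG.
have vsx := image_cent_stable Pu (OC Ox) vs; rewrite mulmxBl -(mulmxA m) sx -scalemxAr in vsx.
have -> : v *m rG x = (v *m rG x - lam x *: (m *m s)) + lam x *: (m *m s) by rewrite subrK.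
apply: addmx_sub; first exact: submx_trans vsx (addsmxSl _ _).
apply: scalemx_sub; rewrite -[m *m s](subrK v); apply: addmx_sub (addsmxSr _ _).
by rewrite -opprB eqmx_opp; apply: submx_trans vs (addsmxSl _ _).
Qed.

Section AbelianComplement.
Hypothesis aO : abelian O.
Hypothesis local_end : forall A, comm_on G A ->
  (exists i : nat, A ^+ i = 0) \/ A \in unitmx.
Variable w : gT.
Hypotheses (Pw : w \in P) (w1 : w != 1%g) (wu : w != u).

Let OJ x : x \in O -> (x ^ w)%g \in O.
Proof. by move=> Ox; rewrite O_conj // (subsetP (klein_sub_cent sylP kP Pu)). Qed.

Let fixedO (m : 'rV[F]_n) x : m *m rG u = m -> x \in O ->
  m *m rG x *m rG u = m *m rG x.
Proof. by move=> mu /OC; apply: fixed_cent. Qed.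

(** The class sum Z of u x avoids the centraliser of P, so it is a sum of proper
    traces. The identity is not, so Z is not invertible but nilpotent. On the
    Brauer quotient at u it acts as x + x^w, because u acts trivially there. As x
    and x^w commute, the 2^i-th power of their sum is the sum of their 2^i-th
    powers. *)
Lemma swap_power x : x \in O -> x \notin 'C(P)%g ->
  exists i : nat, forall m : 'rV_n, m *m rG u = m ->
    (m *m rG (x ^+ (2 ^ i))%g - m *m rG ((x ^ w) ^+ (2 ^ i))%g <= D)%MS.
Proof.
move=> Ox ncx; have Gx := OG Ox; have Gxw := OG (OJ Ox).
pose K := ((u * x) ^: G)%g; pose c y : F := (y \in K)%:R.
have cJ : {in G &, forall y g, c (y ^ g)%g = c y}.
  by move=> y g Gy Gg; rewrite /c memJ_norm // (subsetP (class_norm _ _)).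
have cZ := central_comm cJ; have JZ := central_mod_proper_trace cJ.
have ImZ := fun m => central_mod_image Pu (m := m) cJ.
set Z := \sum_(y in G) _ in cZ JZ ImZ.
have [defK nxw] := class_meet_cent sylP kP Pu u1 aO Ox ncx Pw w1 wu.
have Z0 : exists i : nat, Z ^+ i = 0.
  have [//|uZ] := local_end cZ.
  rewrite big1 ?subr0 in JZ => [|y /setIP[_ cy]]; last first.
    have /negPf nK : y \notin K.
      by apply: contraL cy => Ky; apply: (class_not_cent sylP kP Pu u1 aO Ox ncx).
    by rewrite /c nK scale0r.
  have cZV : comm_on P (invmx Z).
    move=> p Pp; apply: (canRL (mulmxK uZ)).
    by rewrite -mulmxA -cZ ?PG // mulKmx.
  have := proper_trace_fixed vP lP' (proper_traceMl cZV JZ).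
  rewrite mulVmx // mulmx1 vl => /matrixP/(_ 0 0)/eqP.
  by rewrite !mxE oner_eq0.
have [i Zi] := Z0; exists i.
pose E := rG x + rG (x ^ w)%g.
have ZE (m : 'rV_n) : m *m rG u = m -> (m *m Z - m *m E <= D)%MS.
  move=> mu; have := ImZ m mu; congr (_ <= _)%MS; congr (_ - _).
  transitivity (m *m \sum_(y in K :&: 'C_G[u]%g) rG y).
    rewrite (bigID (mem K)) /= [X in _ + X]big1 ?addr0 => [|y /andP[_ /negPf nK]]; last first.
      by rewrite /c nK scale0r.
    congr (m *m _); apply: eq_big => [y|y /andP[_ Ky]]; first by rewrite !inE andbC.
    by rewrite /c Ky scale1r.
  rewrite defK big_setU1 ?big_set1 /=; last first.
    by rewrite inE (inj_eq (mulgI u)).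
  by rewrite (repr_mxM _ Gu Gx) (repr_mxM _ Gu Gxw) !mulmxDr !mulmxA mu.
have Eu : E *m rG u = rG u *m E.
  have cu y : y \in O -> rG y *m rG u = rG u *m rG y.
    by move/OC/setIP=> [Gy /cent1P cy]; rewrite -!repr_mxM // cy.
  by rewrite mulmxDl mulmxDr !cu ?OJ.
have fixE (m : 'rV_n) : m *m rG u = m -> m *m E *m rG u = m *m E.
  by move=> mu; rewrite -mulmxA Eu mulmxA mu.
have DZ (a : 'rV_n) : (a <= D)%MS -> (a *m Z <= D)%MS.
  case/submxP=> b ->; rewrite -mulmxA.
  have -> : D *m Z = Z *m D by rewrite mulmxBl mulmxBr mul1mx mulmx1 cZ.
  by rewrite mulmxA submxMl.
have fixEk k (m : 'rV_n) : m *m rG u = m -> m *m E ^+ k *m rG u = m *m E ^+ k.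
  move=> mu; elim: k => [|k IH]; first by rewrite expr0 mulmx1.
  by rewrite exprSr -mulmxE mulmxA fixE.
have ZEk k (m : 'rV_n) : m *m rG u = m -> (m *m Z ^+ k - m *m E ^+ k <= D)%MS.
  move=> mu; elim: k => [|k IH]; first by rewrite !expr0 subrr sub0mx.
  rewrite !exprSr -!mulmxE !mulmxA.
  have -> : m *m Z ^+ k *m Z - m *m E ^+ k *m E =
     (m *m Z ^+ k - m *m E ^+ k) *m Z + (m *m E ^+ k *m Z - m *m E ^+ k *m E).
    by rewrite mulmxBl addrA subrK.
  by apply: addmx_sub; [apply: DZ | apply/ZE/fixEk].
have EX k : E ^+ (2 ^ k) = rG (x ^+ (2 ^ k))%g + rG ((x ^ w) ^+ (2 ^ k))%g.
  elim: k => [|k IH]; first by rewrite expn0 expr1 !expg1.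
  have Ga : (x ^+ (2 ^ k))%g \in G by rewrite groupX.
  have Gb : ((x ^ w) ^+ (2 ^ k))%g \in G by rewrite groupX.
  have cab : (x ^+ (2 ^ k) * (x ^ w) ^+ (2 ^ k) =
              (x ^ w) ^+ (2 ^ k) * x ^+ (2 ^ k))%g.
    by apply: (centsP aO); rewrite groupX ?OJ.
  rewrite expnSr exprM IH expr2 -mulmxE mulmxDl !mulmxDr -!repr_mxM // -cab.
  rewrite addrACA [X in _ + X]addrC -addrACA addmm addr0.
  by rewrite !muln2 -!addnn !expgD.
move=> m mu; have := ZEk (2 ^ i)%N m mu.
have -> : Z ^+ (2 ^ i) = 0.
  by rewrite -(subnK (ltnW (ltn_expl i (isT : 1 < 2)%N))) exprD Zi mulr0.
by rewrite mulmx0 sub0r EX oppmm mulmxDr (oppmm (m *m rG ((x ^ w) ^+ _)%g)).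
Qed.

(** An element of odd order is a power of each of its 2^i-th powers, so that the
    previous congruence descends to x itself. *)
Lemma swap_involution (m : 'rV_n) x : m *m rG u = m -> x \in O ->
  (m *m rG x - m *m rG (x ^ w)%g <= D)%MS.
Proof.
move=> mu Ox; have [cx|ncx] := boolP (x \in 'C(P)%g).
  have -> : (x ^ w = x)%g by apply/conjg_fixP/commgP; apply: (centP cx).
  by rewrite subrr sub0mx.
have [i swap] := swap_power Ox ncx; set y := (x ^+ (2 ^ i))%g.
have ywE : ((x ^ w) ^+ (2 ^ i) = y ^ w)%g by rewrite conjXg.
have Oy : y \in O by rewrite groupX.
have /cycleP[j xE] : x \in <[y]>%g.
  have ox : odd #[x]%g by move: Ox; rewrite (cent_invol_odd sylP kP Pu u1) => /andP[].
  have gx : generator <[x]>%g y.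
    by rewrite generator_coprime coprimeXr // coprimen2.
  by rewrite -(eqP gx) cycle_id.
have Gy := OG Oy; have Gyw := OG (OJ Oy).
rewrite xE conjXg; elim: j {xE} m mu => [|j IH] m mu; first by rewrite !expg0 subrr sub0mx.
rewrite !expgS (repr_mxM _ Gy (groupX j Gy)) (repr_mxM _ Gyw (groupX j Gyw)) !mulmxA.
have -> : m *m rG y *m rG (y ^+ j)%g - m *m rG (y ^ w)%g *m rG ((y ^ w) ^+ j)%g =
   (m *m rG y *m rG (y ^+ j)%g - m *m rG y *m rG ((y ^ w) ^+ j)%g)
   + (m *m rG y - m *m rG (y ^ w)%g) *m rG ((y ^ w) ^+ j)%g.
  by rewrite mulmxBl addrA subrK.
apply: addmx_sub; first by apply: IH; apply: fixedO.
apply: (image_cent_stable Pu); first by rewrite groupX // OC ?OJ.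
by rewrite -ywE; apply: swap.
Qed.

(** With x = y^2 one has x = (y y^w) (y^w)^-1 y. The first factor commutes with P,
    so it multiplies v by a scalar, and the second one acts trivially on the
    Brauer quotient because y and y^w agree there. *)
Lemma abelian_span x : x \in O -> (v *m rG x <= D + v)%MS.
Proof.
move=> Ox; have ox : odd #[x]%g by move: Ox; rewrite (cent_invol_odd sylP kP Pu u1) => /andP[].
pose y := (x ^+ uphalf #[x])%g.
have Oy : y \in O by rewrite groupX.
have yy : (y * y = x)%g.
  by rewrite -expgD addnn odd_uphalfK // expgS expg_order mulg1.
pose z := (y * y ^ w)%g; pose m := v *m rG ((y ^ w)^-1)%g.
have Oz : z \in O by rewrite groupM ?OJ.
have Nz : z \in N.
  rewrite inE OG //=; apply: (subsetP (cent_sub _)); apply/centP => p.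
  have zw : commute z w.
    apply/commgP/conjg_fixP; rewrite /z conjMg -conjgM (sqP Pw) conjg1.
    by apply: (centsP aO); rewrite ?OJ.
  have zu : commute z u by move: (OC Oz) => /setIP[_ /cent1P].
  have [defP _] := klein_elements kP Pu Pw u1 w1 wu.
  rewrite defP !inE -!orbA => /or4P[] /eqP-> //; first exact: commute1.
  exact: commuteM.
have xE : (x = z * ((y ^ w)^-1 * y))%g.
  by rewrite /z mulgA mulgK yy.
have [Gz Gy Gyw] : [/\ z \in G, y \in G & (y ^ w)%g \in G] by rewrite !OG ?OJ.
have GyV : (y ^ w)^-1%g \in G by rewrite groupV.
rewrite xE (repr_mxM _ Gz (groupM GyV Gy)) mulmxA vN // -scalemxAl scalemx_sub //.
have mu : m *m rG u = m by apply: fixedO; rewrite ?vP ?groupV ?OJ.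
have := swap_involution mu Oy.
rewrite (repr_mxM _ GyV Gy) mulmxA -/m.
have -> : m *m rG (y ^ w)%g = v.
  by rewrite -mulmxA -(repr_mxM _ GyV Gyw) mulVg repr_mx1 mulmx1.
move=> h; rewrite -[m *m _](subrK v); apply: addmx_sub (addsmxSr _ _).
exact: submx_trans h (addsmxSl _ _).
Qed.

End AbelianComplement.
End AtInvolution.

(** Composing a trace from the subgroup generated by u with the projection
    1 - l v, which is itself a trace from 1 to that subgroup, gives a trace from
    1 to P. *)
Lemma proper_trace_projective (B : 'M[F]_n) :
    (forall u, u \in P -> u != 1%g -> 
       exists d, 1%:M - l *m v = d + rG u *m d *m rG u) ->
    J B -> exists d, B *m (1%:M - l *m v) = \sum_(p in P) conj_mx d p.
Proof.
move=> free; set pi := 1%:M - l *m v in free *.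
have cpi x : x \in P -> pi *m rG x = rG x *m pi.
  by move=> Px; rewrite mulmxBl mulmxBr mul1mx mulmx1 -mulmxA vP // mulmxA lP'.
elim=> [|B1 B2 _ [d1 IH1] _ [d2 IH2] | u w C Pu u1 Pw cC].
- by exists 0; rewrite mul0mx big1 // => p _; rewrite /conj_mx mulmx0 mul0mx.
- exists (d1 + d2); rewrite mulmxDl IH1 IH2 -big_split.
  by apply: eq_bigr => p _; rewrite conj_mxD.
have cid : conj_mx C 1 = C by rewrite /conj_mx invg1 repr_mx1 mul1mx mulmx1.
have cu : conj_mx C u = C by rewrite conj_mx_id ?PG.
have [[->|->]|[w1 wu]] : (w = 1%g \/ w = u) \/ (w != 1%g /\ w != u).
- by have [|] := eqVneq w 1%g; have [|] := eqVneq w u; auto.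
- rewrite cid addmm; exists 0; rewrite mul0mx big1 // => p _.
  by rewrite /conj_mx mulmx0 mul0mx.
- rewrite cu addmm; exists 0; rewrite mul0mx big1 // => p _.
  by rewrite /conj_mx mulmx0 mul0mx.
have [d Dd] := free u Pu u1; exists (C *m d).
rewrite (klein_sum _ kP Pu Pw u1 w1 wu).
have e : C *m pi = C *m d + conj_mx (C *m d) u.
  by rewrite Dd mulmxDr /conj_mx Pinv // !mulmxA cC.
have e1 : conj_mx (C *m d) 1 = C *m d by rewrite /conj_mx invg1 repr_mx1 mul1mx mulmx1.
rewrite e1 (conj_mxM _ (PG Pu) (PG Pw)) -e -addrA -conj_mxD -e mulmxDl; congr (_ + _).
by rewrite /conj_mx -!mulmxA cpi.
Qed.

End Decomposed.
End Core.

(** * The Green correspondent of a linear module *)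

Section Final.
Variables (F : fieldType) (gT : finGroupType) (G P : {group gT}).
Hypotheses (ch2 : 2%N \in [pchar F]) (sylP : (2.-Sylow(G) P)%g) (kP : klein_four P).
Local Notation N := 'N_G(P)%G.

Let sPG : P \subset G. Proof. exact: pHall_sub sylP. Qed.

Let natr_odd m : odd m -> m%:R = 1 :> F.
Proof.
move=> om; rewrite -(odd_double_half m) om -muln2 natrD natrM.
by rewrite (pcharf0 ch2) mulr0 addr0.
Qed.

Definition odd_centralizer := [set x in 'C_G(P)%g | odd #[x]%g].
Local Notation H := odd_centralizer.

Lemma odd_centralizer_group : exists2 K : {group gT}, H = K & odd #|K|.
Proof.
have [u [Pu u1 _]] := klein_other kP (group1 P).
exists ('O_(2%N)^'('C_G[u]) :&: 'C(P))%G.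
  apply/setP => x; apply/setIdP/setIP => [[Cx ox] | [Ox cPx]].
    by rewrite (cent_odd_O sylP kP Pu u1 Cx ox); case/setIP: Cx.
  move: Ox; rewrite (cent_invol_odd sylP kP Pu u1) => /andP[/setIP[Gx _] ->].
  by rewrite inE Gx cPx.
by rewrite odd_2'nat; apply: pgroupS (subsetIl _ _) (pcore_pgroup _ _).
Qed.

Lemma odd_centralizer_sub : H \subset N.
Proof.
by apply/subsetP => x /setIdP[/(subsetP (setIS _ (cent_sub _)))].
Qed.

Lemma odd_centralizerJ x g : g \in N -> (x ^ g \in H)%g = (x \in H).
Proof.
move=> Ng; have nC : g \in 'N('C_G(P))%g.
  apply: subsetP Ng; apply: normsI; last exact: norms_cent (subsetIr _ _).
  exact: subset_trans (subsetIl _ _) (normG G).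
by apply/setIdP/setIdP; rewrite orderJ memJ_norm.
Qed.

(** P acts by conjugation with fixed points forming a group of odd order, the
    normal 2-complement of its centraliser. *)
Lemma odd_order_elements_card : odd #|[set x in G | odd #[x]%g]|.
Proof.
set A := [set x in G | _].
have actA : [acts P, on A | 'J].
  apply/actsP => p Pp x; rewrite !inE /= orderJ memJ_norm //.
  by rewrite (subsetP (normG G)) ?(subsetP sPG).
have pP : (2.-group P)%g := pHall_pgroup sylP.
have := pgroup_fix_mod pP actA.
have -> : 'Fix_(A | 'J)(P)%g = H.
  by rewrite afixJ; apply/setP => x; rewrite !(in_setI, in_set) andbAC.
have [K -> oK] := odd_centralizer_group.
by move/eqP; rewrite !modn2 oK; case: odd.
Qed.

(** Here r is the linear N-module and M its Green correspondent. *)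
Variable M : representation F G.
Hypothesis indM : indecomposable M.
Variable (r : mx_representation F N 1).
Hypothesis sumM : is_summand (Representation r) (res_grepr (subsetIl G 'N(P)%g) M).
Let chi x := r x 0 0.

Let localM (A : 'M_(rdegree M)) : comm_on M G A -> (exists i : nat, A ^+ i = 0) \/ A \in unitmx.
Proof. by move=> cA; apply: indecomposable_end_local => //; apply/centgmxP. Qed.

Lemma summand_source : exists (v : 'rV_(rdegree M)) (l : 'cV_(rdegree M)),
  [/\ forall x, x \in N -> v *m M x = chi x *: v,
      forall x, x \in N -> M x *m l = chi x *: l & v *m l = 1%:M].
Proof.
have [L' /mx_rsim_def[B [B' B'B MB]]] := sumM.
have rE x : r x = (chi x)%:M by rewrite [r x]mx11_scalar.
pose v : 'rV_(rdegree M) := @usubmx _ 1 _ _ B'.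
pose l : 'cV_(rdegree M) := @lsubmx _ _ 1 _ B.
have MB' x : x \in N -> B' *m M x = dadd_grepr (Representation r) L' x *m B'.
  by move=> Nx; rewrite [M x](MB x Nx) !mulmxA B'B mul1mx.
have Mx x : x \in N -> M x *m B = B *m dadd_grepr (Representation r) L' x.
  by move=> Nx; rewrite [M x](MB x Nx) -!mulmxA B'B mulmx1.
exists v, l; split.
- move=> x Nx; have := MB' x Nx; rewrite -{1 2}[B']vsubmxK -/v.
  rewrite mul_col_mx [RHS]mul_block_col !mul0mx addr0 => /eq_col_mx[-> _].
  by rewrite rE mul_scalar_mx.
- move=> x Nx; have := Mx x Nx; rewrite -{1 2}[B]hsubmxK -/l.
  rewrite mul_mx_row [RHS]mul_row_block !mulmx0 addr0 => /eq_row_mx[-> _].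
  by rewrite rE mul_mx_scalar.
have := B'B; rewrite -{1}[B']vsubmxK -{1}[B]hsubmxK mul_col_row scalar_mx_block.
by case/eq_block_mx.
Qed.

(** The Brauer quotient at each involution u of P is the line spanned by v. Hence
    1 - l v is a trace from the trivial subgroup on restriction to each
    subgroup of order 2, and then on restriction to P since it is also a sum of
    proper traces. *)
Lemma endo_trivial_of_span (v : 'rV_(rdegree M)) (l : 'cV_(rdegree M)) :
    (forall x, x \in N -> v *m M x = chi x *: v) ->
    (forall x, x \in N -> M x *m l = chi x *: l) -> v *m l = 1%:M ->
    coset_trace P M (l *m v) = 1%:M -> proper_trace P M (1%:M - l *m v) ->
    (forall u, u \in P -> u != 1%g -> forall x, x \in ('O_(2%N)^'('C_G[u]))%g ->
       (v *m M x <= (M u - 1%:M) + v)%MS) ->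
  endo_trivial M.
Proof.
move=> vN lN vl Tv Jv span.
have vP := vector_fixed ch2 sylP kP vN vl.
have lP := functional_fixed ch2 sylP kP vN lN vl.
have free u : u \in P -> u != 1%g -> exists d, 1%:M - l *m v = d + M u *m d *m M u.
  move=> Pu u1; apply: (invol_free ch2 sylP kP vN lN vl Pu).
  by apply: (ker_image_span ch2 sylP kP vN lN vl Tv Pu u1); apply: span.
have [d Dd] := proper_trace_projective ch2 sylP kP vN lN vl free Jv.
apply: (@endo_trivial_criterion _ _ _ M P v l d) => //.
- by case: kP => _ -> _; rewrite (natrM _ 2 2) (pcharf0 ch2) mulr0.
- by rewrite natr_odd ?oner_neq0 ?(sylow_index_odd sylP).
rewrite -[RHS]Dd mulmxBr mulmx1 mulmxBl mul1mx.
by rewrite -mulmxA (mulmxA v) vl mul1mx subrr subr0.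
Qed.

(** The central element attached to the character of L acts on L as the number of
    elements of odd order, which is odd; so it acts invertibly on the whole block. *)
Lemma block_linear_endo_trivial (e : 'M[F]_#|G|) (L : representation F G) :
  is_block e -> in_block e M -> rdegree L = 1%N -> in_block e L ->
  endo_trivial M.
Proof.
case: L => d L; move=> be eM /= d1; move: L; rewrite d1 => L eL.
pose lam x := L x 0 0; pose c := odd_order_weight lam.
have LE x : L x = (lam x)%:M by rewrite [L x]mx11_scalar.
have lamM : {in G &, forall x y, lam (x * y)%g = lam x * lam y}.
  move=> x y Gx Gy; have := repr_mxM L Gx Gy.
  by rewrite !LE -scalar_mxM => /matrixP/(_ 0 0); rewrite !mxE.
have lam1 : lam 1%g = 1 by rewrite /lam repr_mx1 mxE.
have [v0 [l [v0N lN v0l]]] := summand_source.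
have [v [vN vl Tv Jv]] := trivial_source_decomposition ch2 sylP kP v0N lN v0l localM.
apply: (endo_trivial_of_span vN lN vl Tv Jv) => u Pu u1.
apply: (linear_block_span ch2 sylP kP vN vl Pu u1 lamM lam1).
apply: (block_central_unit be eM eL) => [|i].
  exact: odd_order_weightJ.
rewrite (_ : \sum_(x in G) _ = 1%:M).
  by rewrite expr1n; apply: oner_neq0.
rewrite (bigID (fun y : gT => odd #[y]%g)) /= [X in _ + X]big1 ?addr0; last first.
  by move=> x /andP[_ /negPf nx]; rewrite /odd_order_weight nx scale0r.
rewrite (eq_bigr (fun=> 1%:M)) => [|x /andP[Gx ox]]; last first.
  rewrite /odd_order_weight ox LE scale_scalar_mx.
  by rewrite -lamM ?groupV // mulVg lam1.
have := odd_order_elements_card; rewrite cardsE sumr_const -scaler_nat => /natr_odd->.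
by rewrite scale1r.
Qed.

(** The sum of the odd order elements of the centraliser of P is central in kN
    and acts as the identity on the trivial module, hence invertibly on the
    principal block, where any of these elements fixes its image. *)
Lemma principal_block_trivial (e : 'M[F]_#|N|) :
  is_principal_block e -> in_block e (Representation r) ->
  forall x, x \in H -> chi x = 1.
Proof.
move=> [be e1] er; have [K HK oK] := odd_centralizer_group.
have sKN : K \subset N by rewrite -HK odd_centralizer_sub.
pose c x : F := (x \in H)%:R.
have cJ : {in N &, forall x g, c (x ^ g)%g = c x}.
  by move=> x g Nx Ng; rewrite /c odd_centralizerJ.
have sumK (X : representation F N) : \sum_(x in N) c x *: X x = \sum_(x in K) X x.
  transitivity (\sum_(x in N | x \in K) X x).
    rewrite [RHS]big_mkcondr; apply: eq_bigr => x _; rewrite /c HK.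
    by case: (x \in K); rewrite ?scale1r ?scale0r.
  by apply: eq_bigl => x; rewrite andb_idl // => /(subsetP sKN).
have := block_central_unit be er e1 cJ.
rewrite !sumK /= => unitK x; rewrite HK => Kx.
have /unitK : forall i, (\sum_(y in K) (1%:M : 'M[F]_1)) ^+ i != 0.
  move=> i; rewrite sumr_const -scaler_nat natr_odd // scale1r expr1n.
  exact: oner_neq0.
set s := \sum_(y in K) r y => us.
have Nx := subsetP sKN x Kx.
have : r x *m s = s.
  rewrite mulmx_sumr [RHS](reindex_inj (mulgI x)) /=.
  apply: eq_big => [y|y Ky]; first by rewrite groupMl.
  by rewrite repr_mxM // (subsetP sKN).
by move/(canRL (mulmxK us)); rewrite mulmxV // /chi => ->; rewrite mxE.
Qed.

(** With lam trivial, the central element of G is congruent modulo proper traces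
    to the sum of the odd order elements of the centraliser of P, which fixes v0.
    So it is not nilpotent on M, hence invertible. *)
Lemma principal_block_endo_trivial (e : 'M[F]_#|N|) :
  is_principal_block e -> in_block e (Representation r) -> endo_trivial M.
Proof.
move=> pe er; have chi1 := principal_block_trivial pe er.
have [K HK oK] := odd_centralizer_group.
have sKN : K \subset N by rewrite -HK odd_centralizer_sub.
have sKG : K \subset G := subset_trans sKN (subsetIl _ _).
pose lam (x : gT) : F := 1; pose c := odd_order_weight lam.
have lamM : {in G &, forall x y, lam (x * y)%g = lam x * lam y}.
  by move=> x y _ _; rewrite mulr1.
have cJ := odd_order_weightJ lamM (erefl _).
have [v0 [l [v0N lN v0l]]] := summand_source.
have [v [vN vl Tv Jv]] := trivial_source_decomposition ch2 sylP kP v0N lN v0l localM.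
apply: (endo_trivial_of_span vN lN vl Tv Jv) => u Pu u1.
apply: (linear_block_span ch2 sylP kP vN vl Pu u1 lamM (erefl _)).
pose E := \sum_(x in K) M x.
have sumE : \sum_(x in 'C_G(P)%g) c x *: M x = E.
  rewrite /E -HK; transitivity (\sum_(x in 'C_G(P)%g | odd #[x]%g) M x).
    rewrite [RHS]big_mkcondr; apply: eq_bigr => x _; rewrite /c /odd_order_weight.
    by case: odd; rewrite ?scale1r ?scale0r.
  by apply: eq_bigl => x; rewrite [RHS]in_set.
have xE x : x \in K -> M x *m E = E.
  move=> Kx; rewrite mulmx_sumr [RHS](reindex_inj (mulgI x)) /=.
  apply: eq_big => [y|y Ky]; first by rewrite groupMl.
  by rewrite repr_mxM // (subsetP sKG).
apply: (unit_of_proper_trace ch2 sylP kP v0N lN v0l localM (E := E)).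
- exact: central_comm.
- move=> p Pp; rewrite mulmx_suml mulmx_sumr; apply: eq_bigr => x Kx.
  have cxp : (x * p = p * x)%g.
    by move: (Kx); rewrite -HK => /setIdP[/setIP[_ /centP cx] _]; apply: cx.
  have [Gx Gp] := (subsetP sKG x Kx, subsetP sPG p Pp).
  by rewrite -(repr_mxM _ Gx Gp) -(repr_mxM _ Gp Gx) cxp.
- rewrite {1}/E mulmx_suml (eq_bigr (fun=> E)) => [|x /xE//].
  by rewrite sumr_const -scaler_nat natr_odd // scale1r.
- rewrite mulmx_sumr (eq_bigr (fun=> v0)) => [|x Kx].
    by rewrite sumr_const -scaler_nat natr_odd // scale1r.
  by rewrite v0N ?(subsetP sKN) // chi1 ?scale1r // HK.
by rewrite -sumE; apply: central_mod_proper_trace.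
Qed.

Lemma abelian_endo_trivial :
  (forall u, u \in P -> u != 1%g -> abelian ('O_(2%N)^'('C_G[u]))%g) ->
  endo_trivial M.
Proof.
move=> aO; have [v0 [l [v0N lN v0l]]] := summand_source.
have [v [vN vl Tv Jv]] := trivial_source_decomposition ch2 sylP kP v0N lN v0l localM.
apply: (endo_trivial_of_span vN lN vl Tv Jv) => u Pu u1 x Ox.
have [w [Pw w1 wu]] := klein_other kP Pu.
exact: (abelian_span ch2 sylP kP vN lN vl Pu u1 (aO u Pu u1) localM Pw w1 wu Ox).
Qed.

End Final.

Local Close Scope ring_scope.
Local Open Scope group_scope.

Theorem corollary1p3 (gT : finGroupType) (G P : {group gT})
    (k : closedFieldType)
    (sylP : P \in 'Syl_2(G))
    (kleinP : P \isog [set: 'Z_2 * 'Z_2])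
    (chark : 2 \in [pchar k]%R)
    (oneA : representation k 'N_G(P)) (dim_oneA : rdegree oneA = 1%N)
    (M : representation k G)
    (greenM : green_correspondent P (subsetIl G 'N(P)) oneA M) :
  ((exists e : 'M[k]_#|G|,
      [/\ is_block e, in_block e M
        & exists2 L : representation k G, rdegree L = 1%N & in_block e L]) ->
     endo_trivial M)
  /\ ((exists2 e : 'M[k]_#|'N_G(P)|, is_principal_block e & in_block e oneA) ->
        endo_trivial M)
  /\ ((forall u : gT, u \in P -> u <> 1 -> abelian 'O_2^'('C_G[u])) ->
        endo_trivial M).
Proof.
have sP : 2.-Sylow(G) P by rewrite inE in sylP.
have kP := isog_klein_four kleinP.
case: greenM => indM _; case: oneA dim_oneA => d r /= d1; move: r; rewrite d1 => r sumM.
split; [|split].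
- case=> e [be eM [L L1 eL]].
  exact: (block_linear_endo_trivial chark sP kP indM sumM be eM L1 eL).
- case=> e pe er.
  exact: (principal_block_endo_trivial chark sP kP indM sumM pe er).
move=> aO; apply: (abelian_endo_trivial chark sP kP indM sumM) => u Pu u1.
by apply: aO => //; apply/eqP.
Qed.
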